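(* Let $q>1$, and let $(V,E,\mu)$ be a weighted graph with vertex weight $\sigma$ and a $\nu$-adapted edge-length function $\rho$ whose path metric $d_\rho$ is proper (as in the context). Suppose that, for some $o\in V$ and $C>0$, $$\sup_{x\in V}p_\sigma(t,o,x)\le\frac{C}{M_o(\sqrt t)},\qquad t\ge1.$$ If $$\int_1^\infty\frac{r}{M_o(r)^{q-1}}\,dr<\infty,$$ then there exists $a_0>0$ such that, for every $a\in(0,a_0]$, the Cauchy problem $$\partial_tu-\Delta_\sigma u=u^q\ \ (t>0,\ x\in V),\qquad u(0,x)=a\mathbf 1_{\{o\}}(x)\ \ (x\in V),$$ admits a positive global classical solution.
   Context: Let $(V,E)$ be an infinite, connected, locally finite graph with at most one edge between two distinct vertices and no loops. Let $\mu:V\times V\to[0,\infty)$ be symmetric with $\mu_{xy}>0$ if $x\sim y$ and $\mu_{xy}=0$ otherwise; put $\mu(x)=\sum_{y\sim x}\mu_{xy}$. Fix $\sigma:V\to(0,\infty)$ and set $\nu(x)=\sigma(x)\mu(x)$, $\nu(A)=\sum_{x\in A}\nu(x)$. The operator is $$\Delta_\sigma f(x)=\frac1{\nu(x)}\sum_{y\sim x}\mu_{xy}(f(y)-f(x)).$$ A positive symmetric edge-length function $\rho:E\to(0,\infty)$ is $\nu$-adapted if $\sum_{y\sim x}\mu_{xy}\rho(x,y)^2\le\nu(x)$ for all $x\in V$. Its path metric is $d_\rho(x,y)=\inf\sum_{i=1}^n\rho(x_{i-1},x_i)$, the infimum over paths $x=x_0\sim x_1\sim\dots\sim x_n=y$.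 Properness of $d_\rho$ means that every ball $B_\rho(o,r)=\{x\in V:d_\rho(o,x)\le r\}$ is finite. Put $M_o(r)=\nu(B_\rho(o,r))$. For finite connected $D\subset V$, the Dirichlet operator $\Delta_{\sigma,D}$ is obtained by extending functions on $D$ by zero outside $D$ and applying $\Delta_\sigma$ on $D$; $p_{\sigma,D}(t,x,y)$ is its heat kernel with respect to $\nu$, i.e. $e^{t\Delta_{\sigma,D}}f(x)=\sum_{y\in D}p_{\sigma,D}(t,x,y)f(y)\nu(y)$. The minimal heat kernel $p_\sigma(t,x,y)$ is the monotone limit of $p_{\sigma,D_j}(t,x,y)$ along exhaustions of $V$ by finite connected sets $D_j$. A positive global classical solution of the Cauchy problem with datum $u_0$ is a function $u:[0,\infty)\times V\to[0,\infty)$ with $u(\cdot,x)\in C([0,\infty))\cap C^1((0,\infty))$ for every $x\in V$, satisfying the equation pointwise for $t>0$, $u(0,\cdot)=u_0$, and $u(t,x)>0$ for all $t>0$, $x\in V$. *)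

(* Defs.v *)
From HB Require Import structures.
From mathcomp Require Import all_boot all_order all_algebra.
From mathcomp Require Import all_classical all_reals all_analysis.
From mathcomp Require Import ring.

Set Implicit Arguments.
Unset Strict Implicit.
Unset Printing Implicit Defensive.

Import Order.TTheory GRing.Theory Num.Theory.
Import numFieldNormedType.Exports.

Local Open Scope classical_set_scope.
Local Open Scope ring_scope.

Definition connected_in (V : choiceType) (e : rel V) (D : set V) :=
  forall x y, D x -> D y ->
    exists p : seq V, [/\ path e x p, last x p = y & {in p, forall z, D z}].

Record weightedGraph (R : realType) (V : choiceType) := WeightedGraph {
  adj : rel V;
  weight : V -> V -> R;
  adj_sym : symmetric adj;
  adj_irr : irreflexive adj;
  vertices_infinite : infinite_set [set: V];
  adj_connected : connected_in adj [set: V];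
  adj_finite : forall x, finite_set [set y | adj x y];
  weight_sym : forall x y, weight x y = weight y x;
  weight_gt0 : forall x y, adj x y -> 0 < weight x y;
  weight_eq0 : forall x y, ~~ adj x y -> weight x y = 0
}.

Section WeightedGraph.
Context {R : realType} {V : choiceType}.
Variables (G : weightedGraph R V) (sigma : V -> R).

Definition nbh (x : V) : set V := [set y | adj G x y].

Definition mu (x : V) : R := \sum_(y \in nbh x) weight G x y.

Definition nu (x : V) : R := sigma x * mu x.

(* For an infinite A this is the default value 0 unless nu has finite support
   on A; it is only used for balls that are assumed to be finite. *)
Definition nuset (A : set V) : R := \sum_(x \in A) nu x.

Definition laplacian (f : V -> R) (x : V) : R :=
  (nu x)^-1 * \sum_(y \in nbh x) weight G x y * (f y - f x).

Definition edge_length (rho : V -> V -> R) :=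
  forall x y, adj G x y -> 0 < rho x y /\ rho x y = rho y x.

Definition adapted (rho : V -> V -> R) :=
  forall x, \sum_(y \in nbh x) weight G x y * rho x y ^+ 2 <= nu x.

Definition path_length (rho : V -> V -> R) (x : V) (p : seq V) : R :=
  \sum_(l <- pairmap rho x p) l.

(* The empty path is allowed, so that path_dist rho x x = 0. *)
Definition path_dist (rho : V -> V -> R) (x y : V) : R :=
  inf [set path_length rho x p | p in
        [set p : seq V | path (adj G) x p /\ last x p = y]].

Definition dist_ball (rho : V -> V -> R) (o : V) (r : R) : set V :=
  [set x | path_dist rho o x <= r].

Definition proper_dist (rho : V -> V -> R) :=
  forall o r, finite_set (dist_ball rho o r).

Definition volume (rho : V -> V -> R) (o : V) (r : R) : R :=
  nuset (dist_ball rho o r).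

(* Functions on D are identified with functions on V vanishing off D:
   f \_ D is f on D and 0 elsewhere. *)
Definition dirichlet (D : set V) (f : V -> R) : V -> R :=
  laplacian (f \_ D) \_ D.

Definition heat_term (D : set V) (t : R) (f : V -> R) (x : V) : R^nat :=
  fun n => exp_coeff t n * iter n (dirichlet D) (f \_ D) x.

Definition heat_semigroup (D : set V) (t : R) (f : V -> R) (x : V) : R :=
  limn (series (heat_term D t f x)).

(* The kernel of e^{t Delta_D} with respect to nu, obtained by applying the
   semigroup to point masses; see dirichlet_kernelE. It vanishes unless both
   points are in D. *)
Definition dirichlet_kernel (D : set V) (t : R) (x y : V) : R :=
  heat_semigroup D t (\1_[set y]) x / nu y.

Definition exhaustion (D : nat -> set V) :=
  [/\ forall j, finite_set (D j) /\ connected_in (adj G) (D j),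
      forall i j, (i <= j)%N -> D i `<=` D j
    & \bigcup_j D j = [set: V]].

(* The common limit along all exhaustions. *)
Definition minimal_kernel (t : R) (x y : V) : R :=
  get [set l : R | forall D : nat -> set V, exhaustion D ->
        dirichlet_kernel (D j) t x y @[j --> \oo] --> l].

(* u is a positive global classical solution of
   u_t - Delta_sigma u = u^q, u(0, .) = u0. *)
Definition positive_classical_solution (q : R) (u0 : V -> R)
    (u : R -> V -> R) :=
  [/\ forall t x, 0 <= t -> 0 <= u t x,
      forall x, {within `[0, +oo[, continuous (u^~ x)},
      forall x t, 0 < t ->
        derivable (u^~ x) t 1 /\ {for t, continuous (derive1 (u^~ x))},
      forall t x, 0 < t -> derive1 (u^~ x) t - laplacian (u t) x = u t x `^ q
    & (forall x, u 0 x = u0 x) /\ (forall t x, 0 < t -> 0 < u t x)].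

Lemma restrictE (D : set V) (f : V -> R) x :
  (f \_ D) x = if x \in D then f x else 0.
Proof. by []. Qed.

Lemma dirichletE (D : set V) (f : V -> R) x :
  dirichlet D f x = if x \in D then laplacian (f \_ D) x else 0.
Proof. by []. Qed.

Lemma laplacian_sum (s : seq V) (c : V -> R) (g : V -> V -> R) x :
  laplacian (fun z => \sum_(y <- s) c y * g y z) x =
  \sum_(y <- s) c y * laplacian (g y) x.
Proof.
have fin : finite_set (nbh x) by exact: adj_finite.
rewrite /laplacian fsbig_finite //=.
under [RHS]eq_bigr do rewrite mulrCA fsbig_finite //=.
under [RHS]eq_bigr do rewrite mulr_sumr.
rewrite -mulr_sumr exchange_big /=; congr (_ * _); apply: eq_bigr => z _.
rewrite -sumrB mulr_sumr; apply: eq_bigr => y _.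
by rewrite -mulrBr mulrCA.
Qed.

Lemma iter_dirichlet_sum (D : set V) (s : seq V) (c : V -> R)
    (g : V -> V -> R) n x :
  iter n (dirichlet D) ((fun z => \sum_(y <- s) c y * g y z) \_ D) x =
  \sum_(y <- s) c y * iter n (dirichlet D) (g y \_ D) x.
Proof.
elim: n x => [|n IH] x /=.
  rewrite restrictE; under [RHS]eq_bigr do rewrite restrictE.
  by case: ifP => // _; rewrite big1 // => y _; rewrite mulr0.
rewrite dirichletE; under [RHS]eq_bigr do rewrite dirichletE.
case: ifP => [_|_]; last by rewrite big1 // => y _; rewrite mulr0.
rewrite -laplacian_sum; congr laplacian; apply/funext => z.
rewrite restrictE; under [RHS]eq_bigr do rewrite restrictE.
by case: ifP => [_|_]; [exact: IH|rewrite big1 // => y _; rewrite mulr0].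
Qed.

Lemma dirichlet_bounded (D : set V) : finite_set D ->
  exists2 K : R, 0 <= K & forall (f : V -> R) (M : R),
    (forall x, `|f x| <= M) -> forall x, `|dirichlet D f x| <= K * M.
Proof.
move=> Dfin.
pose k x := `|(nu x)^-1| * \sum_(y \in nbh x) `|weight G x y| * 2.
have k0 x : 0 <= k x.
  by rewrite mulr_ge0 // fsumr_ge0 // => y _; rewrite mulr_ge0.
exists (\sum_(x \in D) k x); first by rewrite fsumr_ge0.
move=> f M fM x; have M0 : 0 <= M by exact: le_trans (fM x).
have rM z : `|(f \_ D) z| <= M by rewrite restrictE; case: ifP; rewrite ?normr0.
rewrite dirichletE; case: ifPn => [xD|_]; last first.
  by rewrite normr0 mulr_ge0 ?fsumr_ge0.
apply: (@le_trans _ _ (k x * M)); last first.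
  rewrite ler_wpM2r // (fsbigD1 x) //=; last exact: set_mem.
  by rewrite lerDl fsumr_ge0.
rewrite /laplacian /k normrM -mulrA ler_wpM2l //.
have fin : finite_set (nbh x) by exact: adj_finite.
rewrite !fsbig_finite //= mulr_suml.
apply: le_trans (ler_norm_sum _ _ _) _; apply: ler_sum => y _.
rewrite normrM -mulrA ler_wpM2l // mulr_natl mulr2n.
by apply: le_trans (ler_normB _ _) _; rewrite lerD.
Qed.

Lemma is_cvg_heat (D : set V) t (f : V -> R) x : finite_set D ->
  cvgn (series (heat_term D t f x)).
Proof.
move=> Dfin; have [K K0 HK] := dirichlet_bounded Dfin.
have [M HM] : exists M, forall z, `|(f \_ D) z| <= M.
  exists (\sum_(z \in D) `|f z|) => z; rewrite restrictE.
  case: ifPn => [zD|_]; last by rewrite normr0 fsumr_ge0.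
  rewrite (fsbigD1 z) //=; last exact: set_mem.
  by rewrite lerDl fsumr_ge0.
have itM n z : `|iter n (dirichlet D) (f \_ D) z| <= K ^+ n * M.
  elim: n z => [|n IH] z; first by rewrite expr0 mul1r /=; exact: HM.
  by rewrite exprS -mulrA; apply: HK.
apply: normed_cvg.
apply: (@series_le_cvg _ _ (fun n => M * exp_coeff (`|t| * K) n)) => [n|n|n|].
- exact: normr_ge0.
- rewrite mulr_ge0 //; first exact: le_trans (HM x).
  by rewrite exp_coeff_ge0 // mulr_ge0.
- rewrite /heat_term /exp_coeff /= 2!normrM normfV normrX normr_nat exprMn.
  have -> : M * (`|t| ^+ n * K ^+ n / n`!%:R) =
      `|t| ^+ n / n`!%:R * (K ^+ n * M) by ring.
  by rewrite ler_wpM2l // mulr_ge0 ?exprn_ge0 ?invr_ge0.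
- by apply: is_cvg_seriesZ; exact: is_cvg_series_exp_coeff.
Qed.

(* dirichlet_kernel is the heat kernel of e^{t Delta_D} with respect to nu. *)
Lemma dirichlet_kernelE (D : set V) t (f : V -> R) x :
  (forall y, nu y != 0) -> finite_set D ->
  heat_semigroup D t f x =
  \sum_(y \in D) dirichlet_kernel D t x y * f y * nu y.
Proof.
move=> nu0 Dfin; rewrite fsbig_finite //=; set s := finmap.enum_fset _.
have fE : f \_ D = (fun z => \sum_(y <- s) f y * \1_[set y] z) \_ D.
  apply/funext => z; rewrite !restrictE; case: ifPn => // zD.
  rewrite (bigD1_seq z) /= ?finmap.fset_uniq ?in_fset_set //.
  rewrite indicE mem_set //= mulr1 big1 ?addr0 // => y yz.
  by rewrite indicE memNset ?mulr0 //= => zy; rewrite zy eqxx in yz.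
have -> : heat_semigroup D t f x =
    limn (fun n => \sum_(y <- s) f y *
      series (heat_term D t (\1_[set y]) x) n).
  congr (limn _); apply/funext => n; rewrite /series /=.
  under [RHS]eq_bigr do rewrite mulr_sumr.
  rewrite exchange_big /=; apply: eq_bigr => i _.
  rewrite /heat_term fE iter_dirichlet_sum mulr_sumr.
  by apply: eq_bigr => y _; rewrite mulrCA.
apply/cvg_lim => //.
under [X in _ --> X]eq_bigr => y _.
  rewrite /dirichlet_kernel mulrAC divfK // mulrC.
  over.
by apply: cvg_big => [|y _]; [exact: add_continuous|apply: cvgMl_tmp]; exact: is_cvg_heat.
Qed.

End WeightedGraph.

(* Main.v *)
Require Import Defs.
From mathcomp Require Import all_boot all_order all_algebra.
From mathcomp Require Import all_classical all_reals all_analysis.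
From mathcomp Require Import ring lra.

Import Order.TTheory GRing.Theory Num.Theory.
Import numFieldNormedType.Exports.

Local Open Scope classical_set_scope.
Local Open Scope ring_scope.

Set Implicit Arguments.
Unset Strict Implicit.
Unset Printing Implicit Defensive.

(** The equation is solved by a monotone iteration, and the work is to keep the
    iterates bounded.

    Write the Laplacian as [avg f x - exit_rate x * f x], where [avg] has
    nonnegative coefficients.  Duhamel's formula for the scalar equation
    [v' = g - k v] then turns the Cauchy problem, vertex by vertex, into a fixed
    point equation whose right-hand side is nondecreasing in the unknown and
    involves only finitely many neighbours.  The iterates [picard n] started at
    0 increase with [n], so as soon as they have a uniform bound they converge;
    the bound makes them Lipschitz in time uniformly in [n], so the limit is
    continuous, dominated convergence passes to the limit in the formula, and
    the limit is a classical solution ([solution_is_classical]).  It is positive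
    because the mass put at [o] spreads along edges.

    The bound comes from a supersolution of product form.  Information travels
    one edge per iteration: [picard n] vanishes off the graph ball of radius [n]
    around [o].  It is therefore enough to dominate it by a supersolution of the
    Dirichlet problem on that finite ball ([picard_le_supersolution]), for which
    [phi t * (a * w t x)] serves, where [w] is the Dirichlet heat flow of the
    indicator of [o], as soon as [phi' >= phi ^ q * (a w) ^ (q - 1)].
    By symmetry of the Dirichlet kernel and its domination by the minimal kernel
    ([dirichlet_kernel_sym], [dirichlet_kernel_le_minimal]), the hypothesis on
    the minimal kernel gives a multiple of [1 / M_o(sqrt t)] as a bound for
    [w t] when [t >= 1], on every finite ball at once, and [w <= 1] always.  So a bounded [phi], with values in
    [[1, 2]], exists for small [a] provided [1 / M_o(sqrt t) ^ (q - 1)] is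
    integrable in [t], which is the volume hypothesis after the change of
    variables [t = r ^ 2].  That change of variables is only made
    dyadically: for [t] between [4 ^ k] and [4 ^ k.+1], [w ^ (q - 1)] is at most
    a multiple of [1 / M_o(2 ^ k) ^ (q - 1)], the sum of [4 ^ k / M_o(2 ^ k) ^ (q - 1)]
    converges ([volume_sum_bounded]), and [phi] is a sum of exponential
    relaxations, one for each scale [4 ^ k] ([growth]).

    Nonnegativity, boundedness by 1 and monotonicity in the domain of the
    Dirichlet heat flow all follow from one maximum principle ([comparison]). *)

(** * Real calculus *)

Section RealAnalysis.
Context {R : realType}.
Local Notation leb := (@lebesgue_measure R).

(** The absolute value matters: the power function takes the value 1 at
    negative arguments, so without it continuity fails at 0. *)
Lemma continuous_norm_powR (q : R) : 1 < q ->
  continuous (fun x : R => `|x| `^ q).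
Proof.
move=> q1 x; have [->|x0] := eqVneq x 0.
  rewrite /continuous_at normr0 powR0; last by rewrite gt_eqF// (lt_trans _ q1).
  apply/cvgrPdist_le => e e0; near=> y.
  rewrite sub0r normrN ger0_norm ?powR_ge0//.
  have [->|y0] := eqVneq y 0.
    by rewrite normr0 powR0 ?ltW// gt_eqF// (lt_trans _ q1).
  have ye : `|y| <= e.
    near: y; apply/nbhs_ballP; exists e => //= y; rewrite /ball/= sub0r normrN.
    exact: ltW.
  have y1 : `|y| <= 1.
    near: y; apply/nbhs_ballP; exists 1 => //= y; rewrite /ball/= sub0r normrN.
    exact: ltW.
  by rewrite (le_trans _ ye)// ge1r_powR ?ltW// normr_gt0 y0.
have nx0 : 0 < `|x| by rewrite normr_gt0.
apply: (@continuous_comp _ _ _ (fun x : R => `|x|) (fun y => y `^ q)).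
  exact: norm_continuous.
apply: differentiable_continuous; apply/derivable1_diffP.
by apply: derivable_powR; rewrite in_itv/= nx0.
Unshelve. all: by end_near. Qed.

Lemma ge0_of_derive_ge0 (f df : R -> R) (T : R) : 0 <= T -> continuous f ->
  (forall s, 0 < s -> s < T -> is_derive s 1 f (df s)) ->
  (forall s, 0 < s -> s < T -> 0 <= df s) -> 0 <= f 0 -> 0 <= f T.
Proof.
rewrite le_eqVlt => /predU1P[<- //|T0] fc fd df0 f0.
have [|c|c] := @MVT _ f df 0 T T0.
- by move=> x; rewrite in_itv/= => /andP[]; exact: fd.
- by apply: continuous_subspaceT => x; exact: fc.
rewrite in_itv/= => /andP[c0 cT] /eqP; rewrite subr0 subr_eq => /eqP ->.
by apply: addr_ge0 => //; apply: mulr_ge0; [exact: df0|exact: ltW].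
Qed.

(** A one-sided condition, because in a maximum principle on [[0, T]] the
    minimum may sit at the right end point. *)
Lemma derive_le0_of_left_min (f : R -> R) (t df : R) : 0 < t ->
  is_derive t 1 f df -> (forall s, 0 <= s -> s <= t -> f t <= f s) -> df <= 0.
Proof.
move=> t0 [dfc <-] fmin.
rewrite ['D_1 f t]cvg_at_leftE; last exact: dfc.
apply: limr_le.
  rewrite -(cvg_at_leftE (fun h => h^-1 *: ((f \o shift t) _ - f t)))//.
  apply: cvg_trans dfc; apply: cvg_app.
  move=> A [e egt0 Ae]; exists e => // x xe xgt0; apply: Ae => //.
  exact/ltr0_neq0.
near=> h; have h0 : h < 0 by [].
have ht : - t <= h.
  near: h; exists t => //= h; rewrite /ball_ /= distrC subr0 => + _.
  by move=> /ltr_normlP[? _]; rewrite lerNl ltW.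
apply: mulr_le0_ge0; first by rewrite invr_le0 ltW.
rewrite subr_ge0 [_%:A]mulr1; apply: fmin; rewrite ?gerDr ?(ltW h0)//.
by rewrite -lerBlDr sub0r.
Unshelve. all: by end_near. Qed.

(** The product and difference rules in pointwise form, so that they apply to
    functions given by a formula. *)
Lemma is_derive_mul (f g : R -> R) (x df dg : R) :
  is_derive x 1 f df -> is_derive x 1 g dg ->
  is_derive x 1 (fun s => f s * g s) (f x * dg + g x * df).
Proof. by move=> fd gd; exact: (is_deriveM fd gd). Qed.

Lemma is_derive_sub (f g : R -> R) (x df dg : R) :
  is_derive x 1 f df -> is_derive x 1 g dg ->
  is_derive x 1 (fun s => f s - g s) (df - dg).
Proof. by move=> fd gd; exact: (is_deriveB fd gd). Qed.

Lemma is_derive_expRM (k t : R) :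
  is_derive t 1 (fun s => expR (k * s)) (k * expR (k * t)).
Proof.
rewrite mulrC; apply: (@is_derive1_comp _ expR ( *%R k)).
have kd : is_derive t 1 ( *%R k) (k *: (1 : R)).
  exact: (@is_deriveZ R R R (id : R -> R) k t 1 1 (is_derive_id t 1)).
by rewrite [k in is_derive _ _ _ k](_ : k = k *: (1 : R))// /GRing.scale/= mulr1.
Qed.

Lemma continuous_of_is_derive (f df : R -> R) :
  (forall t : R, is_derive t 1 f (df t)) -> continuous f.
Proof.
move=> fd t; apply: differentiable_continuous; apply/derivable1_diffP.
by have := fd t; case.
Qed.

Lemma continuous_expRM (k : R) : continuous (fun s => expR (k * s)).
Proof. by apply: continuous_of_is_derive => t; exact: is_derive_expRM. Qed.

Lemma continuous_integrable (f : R -> R) (a b : R) : continuous f ->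
  leb.-integrable `[a, b] (EFin \o f).
Proof.
move=> fc; apply: continuous_compact_integrable; first exact: segment_compact.
exact: continuous_subspaceT.
Qed.

Definition primitive (f : R -> R) (t : R) : R := \int[leb]_(s in `[0, t]) f s.

Lemma primitive0 (f : R -> R) (t : R) : t <= 0 -> primitive f t = 0.
Proof.
rewrite /primitive le_eqVlt => /predU1P[->|t0].
  by rewrite set_itv1 Rintegral_set1.
by rewrite set_itv_ge ?Rintegral_set0// bnd_simp -ltNge.
Qed.

Lemma is_derive_primitive (f : R -> R) (t : R) : continuous f -> 0 < t ->
  is_derive t 1 (primitive f) (f t).
Proof.
move=> fc t0.
have [||||dF dE] := @continuous_FTC1_closed R f 0 t (t + 1).
- by rewrite ltrDl.
- exact: continuous_integrable.
- by [].
- exact: fc.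
by split; [exact: dF|rewrite -derive1E; exact: dE].
Qed.

(** Continuity is needed on the whole line; to the left of 0 the primitive
    vanishes because it integrates over an empty interval. *)
Lemma continuous_primitive (f : R -> R) : continuous f -> continuous (primitive f).
Proof.
move=> fc t; have [t0|t0|->] := ltgtP t 0.
- apply: (@near_cst_continuous _ _ 0); near=> s; apply: primitive0; apply: ltW.
  by near: s; exact: lt_nbhsl.
- apply: differentiable_continuous; apply/derivable1_diffP.
  by have := is_derive_primitive fc t0; case.
- rewrite /continuous_at primitive0//.
  apply: (@parameterized_integral_cvg_left R 0 1) => //.
  exact: continuous_integrable.
Unshelve. all: by end_near. Qed.

Lemma le_primitive (f g : R -> R) (t : R) : continuous f -> continuous g ->
  (forall s, 0 <= s -> s <= t -> f s <= g s) -> primitive f t <= primitive g t.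
Proof.
move=> fc gc fg; apply: le_Rintegral => //; try exact: continuous_integrable.
by move=> s /=; rewrite in_itv/= => /andP[]; exact: fg.
Qed.

Lemma primitive_ge0 (f : R -> R) (t : R) :
  (forall s, 0 <= s -> s <= t -> 0 <= f s) ->
  0 <= primitive f t.
Proof.
move=> f0; apply: Rintegral_ge0 => s /=; rewrite in_itv/= => /andP[]; exact: f0.
Qed.

Lemma primitive_gt0 (f : R -> R) (t : R) : continuous f -> 0 < t ->
  (forall s, 0 < s -> s <= t -> 0 < f s) -> 0 < primitive f t.
Proof.
move=> fc t0 f0; have [|c|c] := @MVT _ (primitive f) f 0 t t0.
- by move=> x; rewrite in_itv/= => /andP[x0 _]; exact: is_derive_primitive.
- by apply: continuous_subspaceT; exact: continuous_primitive.
rewrite in_itv/= (@primitive0 _ 0)// !subr0 => /andP[c0 cT] ->.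
by rewrite mulr_gt0// f0// ltW.
Qed.

Lemma cvg_primitive (f_ : nat -> R -> R) (f : R -> R) (B t : R) :
  (forall n, continuous (f_ n)) -> continuous f ->
  (forall n s, 0 <= s -> s <= t -> `|f_ n s| <= B) ->
  (forall s, 0 <= s -> f_ n s @[n --> \oo] --> f s) ->
  primitive (f_ n) t @[n --> \oo] --> primitive f t.
Proof.
move=> f_c fc fB ff.
have [|n|||||fi _ H] := @dominated_convergence _ _ R leb `[0%R, t] _
   (fun n => EFin \o f_ n) (EFin \o f) (EFin \o cst B).
- by [].
- exact: (measurable_int leb (continuous_integrable 0 t (f_c n))).
- exact: (measurable_int leb (continuous_integrable 0 t fc)).
- apply/nearW => s /=; rewrite in_itv/= => /andP[s0 _].
  by apply: cvg_EFin; [exact: nearW|exact: ff].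
- apply: continuous_integrable; exact: cst_continuous.
- apply/nearW => s n /=; rewrite in_itv/= => /andP[s0 st].
  by rewrite lee_fin fB.
apply: fine_cvg; rewrite fineK//.
by apply: integrable_fin_num => //; exact: continuous_integrable.
Qed.

End RealAnalysis.

(** * The Laplacian as a weighted average minus an exit rate *)

Section GraphOperators.
Context {R : realType} {V : choiceType}.
Variables (G : weightedGraph R V) (sigma : V -> R).
Hypothesis sigma_gt0 : forall x, 0 < sigma x.

Local Notation nu := (nu G sigma).
Local Notation lap := (laplacian G sigma).

Definition avg (f : V -> R) (x : V) : R :=
  (nu x)^-1 * \sum_(y \in nbh G x) weight G x y * f y.

Definition exit_rate (x : V) : R := mu G x / nu x.

Lemma weight_ge0 x y : 0 <= weight G x y.
Proof.
have [/weight_gt0/ltW//|/weight_eq0 ->//] := boolP (adj G x y).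
Qed.

(** An infinite connected graph has no isolated vertex; this makes [mu], and
    hence [nu], positive. *)
Lemma exists_neighbor x : exists y, adj G x y.
Proof.
have [y yx] : exists y, y != x.
  apply: contrapT => /forallNP nyx; apply: (@vertices_infinite _ _ G).
  apply: (@sub_finite_set _ _ [set x]); last exact: finite_set1.
  by move=> y _ /=; apply/eqP; move/negP: (nyx y); rewrite negbK.
have [[|z p] []] := @adj_connected _ _ G x y I I.
  by move=> _ /= xy; rewrite xy eqxx in yx.
by move=> /= /andP[xz _] _ _; exists z.
Qed.

Lemma mu_gt0 x : 0 < mu G x.
Proof.
have [y xy] := exists_neighbor x.
rewrite /mu (fsbigD1 y)//=; last exact: adj_finite.
by apply: ltr_pwDl; [exact: weight_gt0|apply: fsumr_ge0 => z _; exact: weight_ge0].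
Qed.

Lemma nu_gt0 x : 0 < nu x.
Proof. by rewrite mulr_gt0// mu_gt0. Qed.

Lemma nu_neq0 x : nu x != 0.
Proof. by rewrite gt_eqF// nu_gt0. Qed.

Lemma avgE f x : avg f x = (nu x)^-1 *
  \sum_(y <- finmap.enum_fset (fset_set (nbh G x))) weight G x y * f y.
Proof. by rewrite /avg fsbig_finite//; exact: adj_finite. Qed.

Lemma laplacianE f x : lap f x = avg f x - exit_rate x * f x.
Proof.
have fin := adj_finite G x.
rewrite /laplacian /avg /exit_rate /mu !fsbig_finite//=.
under eq_bigr do rewrite mulrBr.
by rewrite sumrB -mulr_suml mulrBr; congr (_ - _); rewrite mulrCA mulrA.
Qed.

Lemma exit_rate_gt0 x : 0 < exit_rate x.
Proof. by rewrite divr_gt0 ?mu_gt0 ?nu_gt0. Qed.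

Lemma le_avg f g x : (forall y, f y <= g y) -> avg f x <= avg g x.
Proof.
move=> fg; rewrite !avgE ler_pM2l ?invr_gt0 ?nu_gt0//.
by apply: ler_sum => y _; apply: ler_wpM2l => //; exact: weight_ge0.
Qed.

Lemma avg_cst c x : avg (fun=> c) x = exit_rate x * c.
Proof.
rewrite avgE -mulr_suml mulrA [in RHS]/exit_rate [in RHS]/mu.
by rewrite [in RHS]fsbig_finite/= 1?[_ / _]mulrC//; exact: adj_finite.
Qed.

Lemma avgZ c f x : avg (fun y => c * f y) x = c * avg f x.
Proof.
rewrite !avgE mulrCA [in RHS]mulr_sumr; congr (_ * _).
by apply: eq_bigr => y _; rewrite mulrCA.
Qed.

Lemma avgD f g x : avg (fun y => f y + g y) x = avg f x + avg g x.
Proof.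
rewrite !avgE -mulrDr -big_split/=; congr (_ * _).
by apply: eq_bigr => y _; rewrite mulrDr.
Qed.

Lemma laplacianB f g x : lap (fun y => f y - g y) x = lap f x - lap g x.
Proof.
rewrite !laplacianE.
have -> : (fun y => f y - g y) = (fun y => f y + (-1) * g y).
  by apply/funext => y; rewrite mulN1r.
rewrite avgD avgZ; ring.
Qed.

Lemma laplacianZ c f x : lap (fun y => c * f y) x = c * lap f x.
Proof. by rewrite !laplacianE avgZ; ring. Qed.

Lemma laplacian_cst c x : lap (fun=> c) x = 0.
Proof. by rewrite laplacianE avg_cst subrr. Qed.

Lemma avg_ge0 f x : (forall y, 0 <= f y) -> 0 <= avg f x.
Proof. by move=> f0; rewrite -(mulr0 (exit_rate x)) -avg_cst; exact: le_avg. Qed.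

Lemma avg_gt0 f x y : (forall y, 0 <= f y) -> adj G x y -> 0 < f y ->
  0 < avg f x.
Proof.
move=> f0 xy fy; rewrite /avg mulr_gt0 ?invr_gt0 ?nu_gt0//.
rewrite (fsbigD1 y)//=; last exact: adj_finite.
apply: ltr_pwDl; first by rewrite mulr_gt0// weight_gt0.
by apply: fsumr_ge0 => z _; rewrite mulr_ge0 ?weight_ge0.
Qed.

Lemma cvg_avg T (F : set_system T) {FF : Filter F} (u : T -> V -> R)
  (l : V -> R) x :
  (forall y, u t y @[t --> F] --> l y) ->
  avg (u t) x @[t --> F] --> avg l x.
Proof.
move=> ul; rewrite avgE; under eq_cvg do rewrite avgE.
apply: cvgMl_tmp; apply: cvg_big => [|y _]; first exact: add_continuous.
by apply: cvgMl_tmp; exact: ul.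
Qed.

Lemma cvg_laplacian T (F : set_system T) {FF : Filter F} (u : T -> V -> R)
  (l : V -> R) x :
  (forall y, u t y @[t --> F] --> l y) ->
  lap (u t) x @[t --> F] --> lap l x.
Proof.
move=> ul; rewrite laplacianE; under eq_cvg do rewrite laplacianE.
by apply: cvgB; [exact: cvg_avg|apply: cvgMl_tmp; exact: ul].
Qed.

End GraphOperators.

(** * The Dirichlet heat flow on a finite set *)

Section HeatFlow.
Context {R : realType} {V : choiceType}.
Variables (G : weightedGraph R V) (sigma : V -> R).
Hypothesis sigma_gt0 : forall x, 0 < sigma x.

Local Notation nu := (nu G sigma).
Local Notation lap := (laplacian G sigma).
Local Notation dir := (dirichlet G sigma).
Local Notation heat := (heat_semigroup G sigma).

Implicit Types (D : set V) (t : R) (f : V -> R) (x y z : V).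

Lemma dirichlet_restrict (D : set V) f : (dir D f) \_ D = dir D f.
Proof. by apply/funext => x; rewrite restrictE dirichletE; case: (x \in D). Qed.

Lemma dirichlet_notin (D : set V) f x : ~ D x -> dir D f x = 0.
Proof. by move=> Dx; rewrite dirichletE memNset. Qed.

Lemma dirichlet_in (D : set V) f x : D x -> (forall y, ~ D y -> f y = 0) ->
  dir D f x = lap f x.
Proof.
move=> Dx f0; rewrite dirichletE mem_set//; congr laplacian.
apply/funext => y; rewrite restrictE; case: ifPn => //.
by rewrite notin_setE => /f0 ->.
Qed.

Lemma heat_notin (D : set V) t f x : ~ D x -> heat D t f x = 0.
Proof.
move=> Dx; rewrite /heat_semigroup; apply/cvg_lim => //.
rewrite (_ : series _ = fun=> 0); first exact: cvg_cst.
apply/funext => n; rewrite /series/= big1// => i _; rewrite /heat_term.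
case: i => [|i] /=; first by rewrite restrictE memNset ?mulr0.
by rewrite dirichlet_notin ?mulr0.
Qed.

Lemma heat_term_pseries (D : set V) t f x :
  series (heat_term G sigma D t f x) =
  pseries (fun n => iter n (dir D) (f \_ D) x / n`!%:R) t.
Proof.
rewrite /pseries; congr (series _); apply/funext => n /=.
by rewrite /heat_term /exp_coeff/= mulrC -mulrA; congr (_ * _); exact: mulrC.
Qed.

(** Differentiating the exponential series in time term by term amounts to
    applying the Dirichlet Laplacian to the initial datum. *)
Lemma heat_term_diffs (D : set V) f x :
  pseries_diffs (fun n => iter n (dir D) (f \_ D) x / n`!%:R) =
  (fun n => iter n (dir D) ((dir D (f \_ D)) \_ D) x / n`!%:R).
Proof.
apply/funext => n; rewrite /pseries_diffs dirichlet_restrict -iterSr.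
rewrite factS natrM mulrCA; congr (_ * _).
by rewrite invfM mulrA divff ?mul1r// pnatr_eq0.
Qed.

Lemma laplacian_sumn (c : nat -> R) (g : nat -> V -> R) n x :
  lap (fun y => \sum_(0 <= i < n) c i * g i y) x =
  \sum_(0 <= i < n) c i * lap (g i) x.
Proof.
elim: n => [|n IH].
  rewrite big_geq// (_ : (fun y => _) = fun=> 0).
    by rewrite laplacianE// avg_cst// mulr0 subrr.
  by apply/funext => y; rewrite big_geq.
rewrite big_nat_recr//= -IH !laplacianE//.
rewrite (_ : (fun y => _) =
    (fun y => \sum_(0 <= i < n) c i * g i y + c n * g n y)).
  by rewrite avgD avgZ big_nat_recr//=; ring.
by apply/funext => y; rewrite big_nat_recr.
Qed.

Lemma dirichlet_sumn (D : set V) (c : nat -> R) (g : nat -> V -> R) n x :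
  dir D (fun y => \sum_(0 <= i < n) c i * g i y) x =
  \sum_(0 <= i < n) c i * dir D (g i) x.
Proof.
rewrite dirichletE; under eq_bigr do rewrite dirichletE.
case: (x \in D); last by rewrite big1// => i _; rewrite mulr0.
rewrite -laplacian_sumn; congr laplacian; apply/funext => y; rewrite restrictE.
under [RHS]eq_bigr do rewrite restrictE.
by case: (y \in D) => //; rewrite big1// => i _; rewrite mulr0.
Qed.

Lemma cvg_heat (D : set V) t f x : finite_set D ->
  series (heat_term G sigma D t f x) n @[n --> \oo] --> heat D t f x.
Proof. by move=> Dfin; exact: is_cvg_heat. Qed.

Lemma heat_dirichlet (D : set V) t f x : finite_set D ->
  heat D t (dir D (f \_ D)) x = dir D (heat D t f) x.
Proof.
move=> Dfin; apply/cvg_lim => //.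
have -> : series (heat_term G sigma D t (dir D (f \_ D)) x) =
    fun n => dir D (fun y => series (heat_term G sigma D t f y) n) x.
  apply/funext => n; rewrite /series/= /heat_term dirichlet_sumn.
  by apply: eq_bigr => i _; rewrite dirichlet_restrict -iterSr.
rewrite dirichletE; under eq_cvg do rewrite dirichletE.
case: ifP => _; last exact: cvg_cst.
apply: cvg_laplacian => // y; rewrite restrictE; under eq_cvg do rewrite restrictE.
by case: ifP => _; [exact: cvg_heat|exact: cvg_cst].
Qed.

Lemma is_derive_heat (D : set V) t f x : finite_set D ->
  is_derive t 1 (fun s => heat D s f x) (dir D (heat D t f) x).
Proof.
move=> Dfin; rewrite -heat_dirichlet//.
have heatE s g y : heat D s g y =
    limn (pseries (fun n => iter n (dir D) (g \_ D) y / n`!%:R) s).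
  by rewrite /heat_semigroup heat_term_pseries.
rewrite (_ : (fun s => heat D s f x) = fun s =>
    limn (pseries (fun n => iter n (dir D) (f \_ D) x / n`!%:R) s)); last first.
  by apply/funext => s; exact: heatE.
have cv s g y : cvgn (pseries (fun n => iter n (dir D) (g \_ D) y / n`!%:R) s).
  by rewrite -heat_term_pseries; exact: is_cvg_heat.
rewrite heatE -heat_term_diffs.
apply: (@pseries_snd_diffs R (fun n => iter n (dir D) (f \_ D) x / n`!%:R)
  (`|t| + 1) t).
- exact: cv.
- by rewrite heat_term_diffs; exact: cv.
- by rewrite !heat_term_diffs; exact: cv.
- by rewrite [ltRHS]ger0_norm// ltrDl.
Qed.

Lemma continuous_heat (D : set V) f x : finite_set D ->
  continuous (fun t => heat D t f x).
Proof.
move=> Dfin t; apply: differentiable_continuous; apply/derivable1_diffP.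
by have := is_derive_heat t f x Dfin; case.
Qed.

Lemma heat0 (D : set V) f x : heat D 0 f x = (f \_ D) x.
Proof.
apply/cvg_lim => //; rewrite -(cvg_shiftn 1).
rewrite (_ : [sequence _]_n = fun=> (f \_ D) x); first exact: cvg_cst.
apply/funext => n; rewrite /series/= addn1 big_nat_recl//= big1 ?addr0.
  by rewrite /heat_term/= exp_coeffE /= mulr1 invr1 mul1r.
by move=> i _; rewrite /heat_term /exp_coeff/= expr0n/= mul0r mul0r.
Qed.

Lemma nu_avg D f x : finite_set D -> (forall y, ~ D y -> f y = 0) ->
  nu x * avg G sigma f x = \sum_(y \in D) weight G x y * f y.
Proof.
move=> Dfin f0; rewrite /avg mulrA divff ?nu_neq0// mul1r.
transitivity (\sum_(y \in nbh G x `|` D) weight G x y * f y).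
  apply: fsbig_widen => [y|y [_ /= /negP xy]]; first by left.
  by rewrite weight_eq0 ?mul0r.
apply/esym; apply: fsbig_widen => [y|y [_ /= Dy]]; first by right.
by rewrite f0 ?mulr0.
Qed.

(** The inner product of [l^2(nu)] over [D]. *)
Definition pairing D f g : R := \sum_(x \in D) nu x * (f x * g x).

Lemma dirichlet_selfadjoint D f g : finite_set D ->
  (forall y, ~ D y -> f y = 0) -> (forall y, ~ D y -> g y = 0) ->
  pairing D f (dir D g) = pairing D (dir D f) g.
Proof.
move=> Dfin.
have H u v : (forall y, ~ D y -> u y = 0) -> (forall y, ~ D y -> v y = 0) ->
    pairing D u (dir D v) =
      \sum_(x \in D) \sum_(y \in D) weight G x y * (u x * v y) -
      \sum_(x \in D) nu x * exit_rate G sigma x * (u x * v x).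
  move=> u0 v0; rewrite /pairing !fsbig_finite//= -sumrB; apply: eq_big_seq => x.
  rewrite in_fset_set// => /set_mem Dx.
  rewrite dirichlet_in// laplacianE// mulrBr mulrBr; congr (_ - _); last by ring.
  rewrite mulrCA (nu_avg x Dfin)// !fsbig_finite//= mulr_sumr.
  apply: eq_bigr => y _.
  by rewrite mulrCA.
move=> f0 g0; rewrite H//.
have -> : pairing D (dir D f) g = pairing D g (dir D f).
  by apply: eq_fsbigr => x _; rewrite [_ * g x]mulrC.
rewrite H//; congr (_ - _); last first.
  by apply: eq_fsbigr => x _; rewrite [f x * _]mulrC.
rewrite exchange_fsbig//; apply: eq_fsbigr => x _; apply: eq_fsbigr => y _.
by rewrite weight_sym [f y * _]mulrC.
Qed.

Lemma iter_dirichlet_notin D f n y : (forall y, ~ D y -> f y = 0) -> ~ D y ->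
  iter n (dir D) f y = 0.
Proof. by move=> f0 Dy; case: n => [|n] /=; [exact: f0|exact: dirichlet_notin]. Qed.

Lemma iter_dirichlet_selfadjoint D n f g : finite_set D ->
  (forall y, ~ D y -> f y = 0) -> (forall y, ~ D y -> g y = 0) ->
  pairing D f (iter n (dir D) g) = pairing D (iter n (dir D) f) g.
Proof.
move=> Dfin; elim: n f g => //= n IH f g f0 g0.
rewrite dirichlet_selfadjoint// => [|y]; last exact: iter_dirichlet_notin.
by rewrite IH// -?iterSr// => y; exact: dirichlet_notin.
Qed.

Lemma pairing_delta D x f : finite_set D -> D x ->
  pairing D (\1_[set x]) f = nu x * f x.
Proof.
move=> Dfin Dx; rewrite /pairing (fsbigD1 x)//= fsbig1 ?addr0.
  by rewrite indicE mem_set// mul1r.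
by move=> y /= [_ yx]; rewrite indicE memNset// mul0r mulr0.
Qed.

(** Every power of the Dirichlet Laplacian is self-adjoint for [pairing], which
    is tested here against two point masses, term by term in the series. *)
Lemma dirichlet_kernel_sym D t x y : finite_set D -> D x -> D y ->
  dirichlet_kernel G sigma D t x y = dirichlet_kernel G sigma D t y x.
Proof.
move=> Dfin Dx Dy.
have dE z : D z -> ((\1_[set z] : V -> R) \_ D) = \1_[set z].
  move=> Dz; apply/funext => w; rewrite restrictE; case: ifPn => //.
  rewrite notin_setE => Dw; rewrite indicE memNset// => wz.
  by apply: Dw; rewrite wz.
suff E : heat D t (\1_[set y]) x = nu y / nu x * heat D t (\1_[set x]) y.
  by rewrite /dirichlet_kernel E; field; rewrite !nu_neq0.
apply/cvg_lim => //.
have -> : series (heat_term G sigma D t (\1_[set y]) x) =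
    fun n => nu y / nu x * series (heat_term G sigma D t (\1_[set x]) y) n.
  apply/funext => n; rewrite /series/= mulr_sumr; apply: eq_bigr => i _.
  rewrite /heat_term !dE//.
  have := @iter_dirichlet_selfadjoint D i (\1_[set x]) (\1_[set y]) Dfin.
  have d0 z : D z -> forall w, ~ D w -> \1_[set z] w = 0 :> R.
    by move=> Dz w Dw; rewrite indicE memNset// => wz; apply: Dw; rewrite wz.
  have -> : forall f, pairing D f (\1_[set y]) = pairing D (\1_[set y]) f.
    by move=> f; apply: eq_fsbigr => z _; rewrite [f z * _]mulrC.
  rewrite !pairing_delta// => /(_ (d0 _ Dx) (d0 _ Dy)) E.
  rewrite mulrCA; congr (_ * _); apply: (mulfI (nu_neq0 G sigma_gt0 x)).
  by rewrite E; field; rewrite !nu_neq0.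
by apply: cvgMl_tmp; exact: cvg_heat.
Qed.

Lemma exists_argmin (m : V -> R) (s : seq V) x : x \in s ->
  exists2 y, y \in s & forall z, z \in s -> m y <= m z.
Proof.
elim: s x => // x s IH _ _; case: s IH => [|a s] IH.
  by exists x; rewrite ?mem_head// => z; rewrite inE => /eqP ->.
have [y ys ymin] := IH a (mem_head _ _).
have [xy|yx] := leP (m x) (m y).
  exists x; rewrite ?mem_head// => z; rewrite inE => /predU1P[->//|/ymin].
  exact: le_trans.
exists y; first by rewrite inE ys orbT.
by move=> z; rewrite inE => /predU1P[->|/ymin//]; exact: ltW.
Qed.

(** The minimum of [exp(-t) v] over [D] and [[0, T]], if negative, is attained
    at a positive time [c] and a vertex [y] of [D]. There [v c y] is the minimum
    of [v c] over all vertices, so its Laplacian is nonnegative, whereas the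
    factor [exp(-t)] makes the time derivative of [v] at most [v c y < 0]. *)
Lemma comparison D (v : R -> V -> R) : finite_set D ->
  (forall x, D x -> continuous (v^~ x)) ->
  (forall t x, 0 <= t -> ~ D x -> 0 <= v t x) ->
  (forall x, D x -> 0 <= v 0 x) ->
  (forall t x, 0 < t -> D x ->
    exists2 dv, is_derive t 1 (v^~ x) dv & lap (v t) x <= dv) ->
  forall t x, 0 <= t -> 0 <= v t x.
Proof.
move=> Dfin vc vout v0 vd T x1 T0.
have [Dx1|Dx1] := pselect (D x1); last exact: vout.
rewrite leNgt; apply/negP => vneg.
pose f y s := expR (-1 * s) * v s y.
have fc y : D y -> continuous (f y).
  by move=> Dy s; exact: (continuousM (@continuous_expRM R (-1) s) (vc y Dy s)).
have fmin y : exists c, D y ->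
    0 <= c <= T /\ forall s, 0 <= s -> s <= T -> f y c <= f y s.
  have [Dy|Dy] := pselect (D y); last by exists 0.
  have [c cT cmin] := EVT_min T0 (continuous_subspaceT (fc y Dy)).
  exists c => _; move: cT; rewrite in_itv/= => cT; split => // s s0 sT.
  by apply: cmin; rewrite in_itv/= s0.
have [c cP] := choice fmin.
pose s := finmap.enum_fset (fset_set D).
have sD y : (y \in s) = (y \in D) by rewrite /s in_fset_set.
have [|y] := @exists_argmin (fun y => f y (c y)) s x1.
  by rewrite sD mem_set.
rewrite sD => /set_mem Dy ymin.
have [/andP[c0 cT] cmin] := cP y Dy.
have fgmin z r : D z -> 0 <= r -> r <= T -> f y (c y) <= f z r.
  move=> Dz r0 rT; have [_ /(_ r r0 rT)] := cP z Dz.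
  by apply: le_trans; apply: ymin; rewrite sD mem_set.
have fneg : f y (c y) < 0.
  apply: le_lt_trans (fgmin x1 T Dx1 T0 (lexx _)) _.
  by rewrite /f pmulr_rlt0// expR_gt0.
have vyneg : v (c y) y < 0 by move: fneg; rewrite /f pmulr_rlt0// expR_gt0.
have c_gt0 : 0 < c y.
  rewrite lt_neqAle c0 andbT; apply/negP => /eqP cy.
  by move: vyneg; rewrite -cy ltNge v0.
have [dv dvP lapdv] := vd _ _ c_gt0 Dy.
have : is_derive (c y) 1 (f y) (expR (-1 * c y) * (dv - v (c y) y)).
  have -> : expR (-1 * c y) * (dv - v (c y) y) =
      expR (-1 * c y) * dv + v (c y) y * (-1 * expR (-1 * c y)) by ring.
  exact: (is_derive_mul (is_derive_expRM (-1) (c y)) dvP).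
move=> /(derive_le0_of_left_min c_gt0) H.
have : expR (-1 * c y) * (dv - v (c y) y) <= 0.
  by apply: H => r r0 rc; apply: cmin => //; exact: le_trans rc cT.
rewrite pmulr_rle0 ?expR_gt0// subr_le0 => dvle.
suff : 0 <= lap (v (c y)) y.
  by rewrite leNgt (le_lt_trans lapdv)// (le_lt_trans dvle).
rewrite laplacianE// subr_ge0 -avg_cst//; apply: le_avg => // z.
have [Dz|Dz] := pselect (D z); last by apply: le_trans (ltW vyneg) _; exact: vout.
by have := fgmin z _ Dz c0 cT; rewrite /f ler_pM2l// expR_gt0.
Qed.

End HeatFlow.

(** * Bounds on heat kernels and the minimal kernel *)

Section HeatBounds.
Context {R : realType} {V : choiceType}.
Variables (G : weightedGraph R V) (sigma : V -> R).
Hypothesis sigma_gt0 : forall x, 0 < sigma x.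

Local Notation nu := (nu G sigma).
Local Notation lap := (laplacian G sigma).
Local Notation heat := (heat_semigroup G sigma).
Local Notation kernel := (dirichlet_kernel G sigma).

Implicit Types (D : set V) (t : R) (f : V -> R) (x y z : V).

Lemma is_derive_heat_in D t f x : finite_set D -> D x ->
  is_derive t 1 (fun s => heat D s f x) (lap (heat D t f) x).
Proof.
move=> Dfin Dx; have := is_derive_heat G sigma t f x Dfin.
by rewrite dirichlet_in// => y; exact: heat_notin.
Qed.

Lemma heat_ge0 D t f x : finite_set D -> (forall y, 0 <= f y) -> 0 <= t ->
  0 <= heat D t f x.
Proof.
move=> Dfin f0.
apply: (@comparison _ _ _ _ sigma_gt0 D (fun t => heat D t f)) => //.
- by move=> y _; exact: continuous_heat.
- by move=> s y _ Dy; rewrite heat_notin.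
- by move=> y Dy; rewrite heat0 restrictE; case: ifP.
- move=> s y _ Dy; exists (lap (heat D s f) y) => //; exact: is_derive_heat_in.
Qed.

Lemma heat_le D t f c x : finite_set D -> 0 <= c -> (forall y, f y <= c) ->
  0 <= t -> heat D t f x <= c.
Proof.
move=> Dfin c0 fc t0; rewrite -subr_ge0.
apply: (@comparison _ _ _ _ sigma_gt0 D (fun t y => c - heat D t f y)) => //.
- move=> y _ s; apply: continuousB; first exact: cst_continuous.
  exact: continuous_heat.
- by move=> s y _ Dy; rewrite heat_notin// subr0.
- by move=> y Dy; rewrite heat0 restrictE subr_ge0; case: ifP.
- move=> s y _ Dy; exists (0 - lap (heat D s f) y).
    by apply: is_derive_sub; exact: is_derive_heat_in.
  by rewrite laplacianB laplacian_cst.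
Qed.

Lemma le_heat D D' t f x : finite_set D -> finite_set D' -> D `<=` D' ->
  (forall y, 0 <= f y) -> 0 <= t -> heat D t f x <= heat D' t f x.
Proof.
move=> Dfin D'fin DD' f0 t0; rewrite -subr_ge0.
apply: (@comparison _ _ _ _ sigma_gt0 D
  (fun t y => heat D' t f y - heat D t f y)) => //.
- by move=> y _ s; apply: continuousB; exact: continuous_heat.
- by move=> s y s0 Dy; rewrite [X in _ - X]heat_notin// subr0 heat_ge0.
- by move=> y Dy; rewrite !heat0 !restrictE !mem_set ?subrr//; exact: DD'.
- move=> s y _ Dy; exists (lap (heat D' s f) y - lap (heat D s f) y).
    apply: is_derive_sub; apply: is_derive_heat_in => //; exact: DD'.
  by rewrite laplacianB.
Qed.

(** Combinatorial balls. They both exhaust the graph and follow the support of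
    the iterates below. *)
Fixpoint gball (o : V) (n : nat) : set V :=
  if n is m.+1 then gball o m `|` \bigcup_(x in gball o m) nbh G x else [set o].

Lemma gball_finite o n : finite_set (gball o n).
Proof.
elim: n => [|n IH] /=; first exact: finite_set1.
rewrite finite_setU; split => //; apply: bigcup_finite => // x _.
exact: adj_finite.
Qed.

Lemma gballS o n : gball o n `<=` gball o n.+1.
Proof. by move=> x; left. Qed.

Lemma gball_mono o : {homo gball o : m n / (m <= n)%N >-> m `<=` n}.
Proof.
move=> m n /subnK <-; elim: (n - m)%N => // k IH.
by apply: subset_trans IH _; exact: gballS.
Qed.

Lemma gball_center o n : gball o n o.
Proof. by apply: (@gball_mono o 0%N n). Qed.

Lemma gball_path o n x : gball o n x ->
  exists p, [/\ path (adj G) x p, last x p = o & {in p, forall z, gball o n z}].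
Proof.
elim: n x => [x /= ->|n IH x]; first by exists [::].
case=> [/IH[p [xp po pB]]|[y yB /= yx]].
  by exists p; split => // z zp; left; exact: pB.
have [p [yp po pB]] := IH y yB.
exists (y :: p); split => //=; first by rewrite adj_sym yx.
by move=> z; rewrite inE => /predU1P[->|/pB]; left.
Qed.

(** Any two points are joined through the centre. *)
Lemma gball_connected o n : connected_in (adj G) (gball o n).
Proof.
move=> x y Bx By; have [p [xp po pB]] := gball_path Bx.
have [r [yr ro rB]] := gball_path By.
exists (p ++ rev (belast y r)); split.
- rewrite cat_path xp po -ro rev_path.
  by rewrite (@eq_path _ _ (adj G))// => u v /=; rewrite adj_sym.
- rewrite last_cat po; case: r {yr rB} ro => [<-//|a r _].
  by rewrite /= rev_cons last_rcons.
- move=> z; rewrite mem_cat mem_rev => /orP[/pB//|/mem_belast].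
  by rewrite inE => /predU1P[->//|/rB].
Qed.

Lemma gball_cover o : \bigcup_n gball o n = [set: V].
Proof.
apply/seteqP; split => // x _.
have [p [+ <- _]] := @adj_connected _ _ G o x I I.
elim/last_ind: p => [|p y IH]; first by exists 0%N.
rewrite rcons_path last_rcons => /andP[/IH[n _ Bn] py].
by exists n.+1 => //; right; exists (last o p).
Qed.

Lemma gball_exhaustion o : exhaustion G (gball o).
Proof.
split; [|exact: gball_mono|exact: gball_cover].
by move=> j; split; [exact: gball_finite|exact: gball_connected].
Qed.

Lemma finite_sub_exhaustion D (E : nat -> set V) : finite_set D ->
  exhaustion G E -> exists j, D `<=` E j.
Proof.
move=> Dfin [_ Emono Ecov].
have [j jP] : exists j : V -> nat, forall x, E (j x) x.
  suff /choice[j jP] : forall x, exists j, E j x by exists j.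
  move=> x; have : (\bigcup_j E j) x by rewrite Ecov.
  by case=> j _; exists j.
exists (\max_(x <- finmap.enum_fset (fset_set D)) j x) => x Dx.
apply: (Emono (j x)); last exact: jP.
by rewrite leq_bigmax_seq// in_fset_set// mem_set.
Qed.

Lemma le_dirichlet_kernel D D' t x y : finite_set D -> finite_set D' -> D `<=` D' ->
  0 <= t -> kernel D t x y <= kernel D' t x y.
Proof.
move=> Df D'f DD' t0; rewrite ler_wpM2r ?invr_ge0 ?(ltW (nu_gt0 G sigma_gt0 y))//.
by apply: le_heat.
Qed.

Lemma dirichlet_kernel_le_inv D t x y : finite_set D -> 0 <= t ->
  kernel D t x y <= (nu y)^-1.
Proof.
move=> Df t0; rewrite -[leRHS]mul1r.
rewrite ler_wpM2r ?invr_ge0 ?(ltW (nu_gt0 G sigma_gt0 y))//.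
by apply: heat_le => // z; rewrite indicE lern1 leq_b1.
Qed.

(** Since the Dirichlet kernels increase with the domain and are bounded, they
    converge along every exhaustion to their supremum over all finite sets. So
    the choice defining [minimal_kernel] is not vacuous, and evaluating it along
    the exhaustion by graph balls identifies it with this supremum. *)
Lemma dirichlet_kernel_le_minimal D t x y : finite_set D -> 0 <= t ->
  kernel D t x y <= minimal_kernel G sigma t x y.
Proof.
move=> Df t0.
pose S := [set kernel E t x y | E in [set E | finite_set E]].
have Sub : has_ubound S.
  by exists (nu y)^-1 => _ [E Ef <-]; exact: dirichlet_kernel_le_inv.
have Ssup : has_sup S.
  split => //; exists (kernel set0 t x y).
  by exists set0 => //=; exact: finite_set0.
have limS E : exhaustion G E -> kernel (E j) t x y @[j --> \oo] --> sup S.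
  move=> Eex; have [Efin Emono _] := Eex.
  apply/cvgrPdist_le => e e0.
  have [_ [F Ff <-] Flt] := sup_adherent e0 Ssup.
  have [j FE] := finite_sub_exhaustion Ff Eex.
  near=> k; have jk : (j <= k)%N by near: k; exact: nbhs_infty_ge.
  have FEk : kernel F t x y <= kernel (E k) t x y.
    apply: le_dirichlet_kernel => //; first by have [] := Efin k.
    by apply: subset_trans FE _; exact: Emono.
  have Ek : kernel (E k) t x y <= sup S.
    by apply: ub_le_sup => //; exists (E k) => //; have [] := Efin k.
  rewrite ger0_norm ?subr_ge0// lerBlDr -lerBlDl.
  by apply: le_trans FEk; exact: ltW.
have := @getPex _ [set l : R | forall E : nat -> set V, exhaustion G E ->
    kernel (E j) t x y @[j --> \oo] --> l] (ex_intro _ _ limS).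
move=> /(_ _ (gball_exhaustion x)) lim.
have -> : minimal_kernel G sigma t x y = sup S.
  exact: (cvg_unique _ lim (limS _ (gball_exhaustion x))).
by apply: ub_le_sup => //; exists D.
Unshelve. all: by end_near. Qed.

End HeatBounds.

(** * From the volume integral to a dyadic sum *)

Section DyadicSum.
Import measurable_realfun.
Context {R : realType}.
Local Notation leb := (@lebesgue_measure R).
Local Open Scope ereal_scope.

(** On [[2^k, 2^(k+1)[], of length [2^k], the integrand is at least
    [2^k * h (2^(k+1))]. *)
Lemma dyadic_le_integral (h : R -> R) (n : nat) :
  {homo h : r s / (r <= s)%R >-> (s <= r)%R} -> (forall r, 0 <= h r)%R ->
  ((\sum_(0 <= k < n) 4 ^+ k * h (2 ^+ k.+1))%:E <=
   \int[leb]_(r in `[1%R, (2 ^+ n)%R[) (r * h r)%:E)%E.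
Proof.
move=> hni h0.
have mh (D : set R) : measurable D -> measurable_fun D (fun r => (r * h r)%:E).
  move=> mD; apply/measurable_EFinP; apply: measurable_funM => //.
  by apply: nonincreasing_measurable.
elim: n => [|n IH].
  rewrite big_geq// integral_ge0// => r /=.
  by rewrite in_itv/= expr0 ltNge; case: leP.
rewrite big_nat_recr//= EFinD.
have n1 : (1 <= 2 ^+ n :> R)%R by rewrite exprn_ege1// ler1n.
have nn : (2 ^+ n <= 2 ^+ n.+1 :> R)%R by rewrite ler_eXn2l// ltr1n.
rewrite (@itv_bndbnd_setU _ _ _ (BLeft (2 ^+ n)%R)) ?bnd_simp//.
rewrite ge0_integral_setU//=; first last.
- apply/disj_setPS => r [] /=; rewrite !in_itv/= => /andP[_ +] /andP[+ _].
  by move=> /lt_le_trans/[apply]; rewrite ltxx.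
- move=> r [] /=; rewrite in_itv/= => /andP[r1 _]; rewrite lee_fin mulr_ge0//.
    exact: le_trans r1.
  by apply: le_trans r1; exact: le_trans n1.
- by apply: mh; exact: measurableU.
apply: leeD => //.
apply: (@le_trans _ _ (\int[leb]_(r in `[(2 ^+ n)%R, (2 ^+ n.+1)%R[)
    (2 ^+ n * h (2 ^+ n.+1))%:E)).
  rewrite integral_cst//= lebesgue_measure_itv/= lte_fin ltr_eXn2l ?ltr1n// ltnSn.
  rewrite -EFinB -EFinM lee_fin le_eqVlt; apply/orP; left; apply/eqP.
  rewrite exprS (_ : 4 = 2 * 2)%R ?exprMn; first by ring.
  by rewrite -natrM.
apply: ge0_le_integral => //.
- by move=> r _; rewrite lee_fin mulr_ge0// exprn_ge0.
- exact: mh.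
- move=> r /=; rewrite in_itv/= => /andP[r1 r2].
  rewrite lee_fin ler_pM// ?exprn_ge0//.
  by apply: hni; exact: ltW.
Qed.

(** Monotonicity is only assumed from 1 on, whereas measurability of [h] is
    obtained from monotonicity on the whole line, whence the truncation of the
    argument at 1 in the proof. *)
Lemma dyadic_sum_bounded (h : R -> R) :
  (forall r s, 1 <= r -> r <= s -> h s <= h r)%R -> (forall r, 0 <= h r)%R ->
  \int[leb]_(r in `[1%R, +oo[) (r * h r)%:E < +oo ->
  exists S : R, forall n : nat, (\sum_(0 <= k < n) 4 ^+ k * h (2 ^+ k) <= S)%R.
Proof.
move=> hni h0 hfin.
pose h' r := h (Num.max r 1%R).
have h'ni : {homo h' : r s / (r <= s)%R >-> (s <= r)%R}.
  move=> r s rs; apply: hni; first by rewrite le_max lexx orbT.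
  by rewrite ge_max le_max rs le_max lexx orbT.
have h'E r : (1 <= r)%R -> h' r = h r by move=> r1; rewrite /h' max_l.
have h'0 r : (0 <= h' r)%R by exact: h0.
pose I := \int[leb]_(r in `[1%R, +oo[) (r * h r)%:E.
have I0 : 0 <= I.
  apply: integral_ge0 => r /=; rewrite in_itv/= andbT => r1.
  by rewrite lee_fin mulr_ge0// (le_trans _ r1).
have If : I \is a fin_num by rewrite ge0_fin_numE.
have bound n : (\sum_(0 <= k < n) 4 ^+ k * h (2 ^+ k.+1) <= fine I)%R.
  rewrite -lee_fin fineK//.
  have := @dyadic_le_integral h' n h'ni h'0.
  under eq_bigr => k _ do rewrite h'E ?exprn_ege1 ?ler1n//.
  move=> /le_trans; apply.
  have -> : I = \int[leb]_(r in `[1%R, +oo[) (r * h' r)%:E.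
    by apply: eq_integral => r; rewrite inE/= in_itv/= andbT => r1; rewrite h'E.
  apply: ge0_subset_integral => //.
  - apply/measurable_EFinP; apply: measurable_funM => //.
    by apply: nonincreasing_measurable.
  - move=> r /=; rewrite in_itv/= andbT => r1.
    by rewrite lee_fin mulr_ge0// (le_trans _ r1).
  - by apply: subset_itvl; rewrite bnd_simp.
exists (h 1 + 4 * fine I)%R => -[|n].
  by rewrite big_geq// addr_ge0// mulr_ge0// fine_ge0.
rewrite big_nat_recl//= !expr0 mul1r lerD2l.
apply: le_trans (ler_wpM2l _ (bound n)) => //.
by rewrite mulr_sumr; apply: ler_sum => k _; rewrite exprS mulrA.
Qed.

End DyadicSum.

Section Volume.
Context {R : realType} {V : choiceType}.
Variables (G : weightedGraph R V) (sigma : V -> R) (rho : V -> V -> R).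
Hypothesis sigma_gt0 : forall x, 0 < sigma x.
Hypothesis rho_length : edge_length G rho.
Hypothesis rho_proper : proper_dist G rho.

Local Notation vol := (volume G sigma rho).

Lemma le_volume o r s : r <= s -> vol o r <= vol o s.
Proof.
move=> rs; have fs : finite_set (dist_ball G rho o s) by exact: rho_proper.
rewrite [leRHS](fsbigID (dist_ball G rho o r))//= setIidr; last first.
  by move=> x xr; exact: le_trans rs.
by rewrite lerDl fsumr_ge0// => x _; rewrite ltW ?nu_gt0.
Qed.

Lemma path_length_ge0 x p : path (adj G) x p -> 0 <= path_length rho x p.
Proof.
rewrite /path_length; elim: p x => [|y p IH] x /=; first by rewrite big_nil.
move=> /andP[xy yp]; rewrite big_cons addr_ge0 ?IH//.
by have [/ltW] := rho_length xy.
Qed.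

Lemma path_dist_refl o : path_dist G rho o o <= 0.
Proof.
apply: ge_inf.
  by exists 0 => _ [p [xp _] <-]; exact: path_length_ge0.
by exists [::] => //; rewrite /path_length big_nil.
Qed.

Lemma volume_gt0 o r : 0 <= r -> 0 < vol o r.
Proof.
move=> r0.
have Bo : dist_ball G rho o r o by exact: le_trans (path_dist_refl o) r0.
have fin : finite_set (dist_ball G rho o r) by exact: rho_proper.
rewrite /volume /nuset (fsbigD1 o)//=.
apply: ltr_pwDl; first exact: nu_gt0.
by apply: fsumr_ge0 => x _; apply: ltW; exact: nu_gt0.
Qed.

Lemma volume_sum_bounded o (p : R) : 0 < p ->
  (\int[lebesgue_measure]_(r in `[(1%R : R), +oo[)
     (r / vol o r `^ p)%:E < +oo)%E ->
  exists S : R, forall n : nat,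
    \sum_(0 <= k < n) 4 ^+ k / vol o (2 ^+ k) `^ p <= S.
Proof.
move=> p0; apply: (@dyadic_sum_bounded R (fun r => (vol o r `^ p)^-1)).
  move=> r s r1 rs; have r0 : 0 <= r by rewrite (le_trans _ r1).
  have vr : 0 < vol o r by exact: volume_gt0.
  have vs : 0 < vol o s by exact: lt_le_trans vr (le_volume o rs).
  rewrite lef_pV2 ?posrE ?powR_gt0//.
  by apply: ge0_ler_powR; rewrite ?nnegrE ?(ltW p0) ?(ltW vr) ?(ltW vs)// le_volume.
by move=> r; rewrite invr_ge0 powR_ge0.
Qed.

End Volume.

(** * Duhamel's formula for a scalar linear equation *)

Section Duhamel.
Context {R : realType}.

Implicit Types (k c s t : R) (g : R -> R).

(** The solution of [v' = g - k v] with [v 0 = c]. Unlike plain integration of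
    the Laplacian, this form is monotone in [g] and keeps [g] free of the
    negative diagonal term. *)
Definition duhamel (k c : R) (g : R -> R) (t : R) : R :=
  expR (- k * t) * (c + primitive (fun s => expR (k * s) * g s) t).

Lemma continuous_expR_weight (k : R) (g : R -> R) : continuous g ->
  continuous (fun s => expR (k * s) * g s).
Proof.
by move=> gc s; exact: (continuousM (@continuous_expRM R k s) (gc s)).
Qed.

Lemma continuous_duhamel k c (g : R -> R) : continuous g ->
  continuous (duhamel k c g).
Proof.
move=> gc t.
apply: (continuousM (@continuous_expRM R (- k) t)).
apply: (@continuousD _ _ _ (cst c)); first exact: cst_continuous.
exact: (continuous_primitive (@continuous_expR_weight k g gc)).
Qed.

Lemma duhamel0 k c (g : R -> R) : duhamel k c g 0 = c.
Proof. by rewrite /duhamel primitive0// mulr0 expR0 mul1r addr0. Qed.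

Lemma duhamel_expR k c (g : R -> R) t :
  c + primitive (fun s => expR (k * s) * g s) t = expR (k * t) * duhamel k c g t.
Proof. by rewrite /duhamel mulrA -expRD mulNr subrr expR0 mul1r. Qed.

Lemma is_derive_duhamel k c (g : R -> R) t : continuous g -> 0 < t ->
  is_derive t 1 (duhamel k c g) (g t - k * duhamel k c g t).
Proof.
move=> gc t0.
have pd := is_derive_primitive (@continuous_expR_weight k g gc) t0.
have cd : is_derive t 1 (fun s => c + primitive (fun s => expR (k * s) * g s) s)
    (expR (k * t) * g t).
  by rewrite -[X in is_derive _ _ _ X]add0r; exact: is_deriveD.
have := is_derive_mul (is_derive_expRM (- k) t) cd.
have -> // : expR (- k * t) * (expR (k * t) * g t) +
   (c + primitive (fun s => expR (k * s) * g s) t) * (- k * expR (- k * t)) =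
   g t - k * duhamel k c g t.
have e1 : expR (- k * t) * expR (k * t) = 1 by rewrite -expRD mulNr addNr expR0.
by rewrite mulrA e1 mul1r /duhamel; ring.
Qed.

Lemma le_duhamel k c (f g : R -> R) t : continuous f -> continuous g ->
  (forall s, 0 <= s -> f s <= g s) -> duhamel k c f t <= duhamel k c g t.
Proof.
move=> fc gc fg; rewrite ler_pM2l ?expR_gt0// lerD2l.
apply: le_primitive; try exact: continuous_expR_weight.
by move=> s s0 _; rewrite ler_pM2l ?expR_gt0// fg.
Qed.

Lemma duhamel_ge0 k c (g : R -> R) t : 0 <= c -> (forall s, 0 <= s -> 0 <= g s) ->
  0 <= duhamel k c g t.
Proof.
move=> c0 g0; rewrite mulr_ge0 ?expR_ge0// addr_ge0//.
by apply: primitive_ge0 => s s0 _; rewrite mulr_ge0 ?expR_ge0 ?g0.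
Qed.

Lemma duhamel_gt0l k c (g : R -> R) t : 0 < c -> (forall s, 0 <= s -> 0 <= g s) ->
  0 < duhamel k c g t.
Proof.
move=> c0 g0; rewrite mulr_gt0 ?expR_gt0// ltr_pwDl//.
by apply: primitive_ge0 => s s0 _; rewrite mulr_ge0 ?expR_ge0 ?g0.
Qed.

Lemma duhamel_gt0r k c (g : R -> R) t : 0 <= c -> continuous g -> 0 < t ->
  (forall s, 0 < s -> 0 < g s) -> 0 < duhamel k c g t.
Proof.
move=> c0 gc t0 g0; rewrite mulr_gt0 ?expR_gt0// ltr_wpDl//.
apply: primitive_gt0 => //; first exact: continuous_expR_weight.
by move=> s s0 _; rewrite mulr_gt0 ?expR_gt0 ?g0.
Qed.

Lemma duhamel_lipschitz k c (g : R -> R) (B M : R) : continuous g -> 0 <= k ->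
  (forall s, 0 <= s -> `|g s| <= B) ->
  (forall s, 0 <= s -> `|duhamel k c g s| <= M) ->
  forall s t, 0 <= s -> 0 <= t ->
    `|duhamel k c g t - duhamel k c g s| <= (B + k * M) * `|t - s|.
Proof.
move=> gc k0 gB dM.
have main s t : 0 <= s -> s < t ->
    `|duhamel k c g t - duhamel k c g s| <= (B + k * M) * `|t - s|.
  move=> s0 st.
  have [|r|r] := @MVT _ (duhamel k c g) (fun t => g t - k * duhamel k c g t) s t st.
  - move=> r; rewrite in_itv/= => /andP[sr _].
    by apply: is_derive_duhamel => //; exact: le_lt_trans sr.
  - by apply: continuous_subspaceT; exact: continuous_duhamel.
  rewrite in_itv/= => /andP[sr _] ->; have r0 := le_trans s0 (ltW sr).
  rewrite normrM ler_wpM2r//; apply: le_trans (ler_normB _ _) _.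
  by rewrite lerD ?gB// normrM (ger0_norm k0) ler_wpM2l ?dM.
move=> s t s0 t0; have [st|ts|->] := ltgtP s t.
- exact: main.
- by rewrite distrC [`|t - s|]distrC; exact: main.
- by rewrite !subrr normr0 mulr0.
Qed.

Lemma cvg_duhamel k c (g_ : nat -> R -> R) (g : R -> R) (B t : R) :
  (forall n, continuous (g_ n)) -> continuous g ->
  (forall n s, 0 <= s -> `|g_ n s| <= B) -> 0 <= k ->
  (forall s, 0 <= s -> g_ n s @[n --> \oo] --> g s) ->
  duhamel k c (g_ n) t @[n --> \oo] --> duhamel k c g t.
Proof.
move=> g_c gc gB k0 gg; apply: cvgMl_tmp; apply: cvgD; first exact: cvg_cst.
apply: (@cvg_primitive _ _ _ (expR (k * t) * B)).
- by move=> n; exact: continuous_expR_weight.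
- exact: continuous_expR_weight.
- move=> n s s0 st; rewrite normrM ger0_norm ?expR_ge0// ler_pM ?expR_ge0 ?gB//.
  by rewrite ler_expR ler_wpM2l.
- by move=> s s0; apply: cvgMl_tmp; exact: gg.
Qed.

End Duhamel.

(** * The monotone iteration *)

Section Picard.
Context {R : realType} {V : choiceType}.
Variables (G : weightedGraph R V) (sigma : V -> R).
Hypothesis sigma_gt0 : forall x, 0 < sigma x.
Variables (q : R) (o : V) (a : R).
Hypotheses (q_gt1 : 1 < q) (a_gt0 : 0 < a).

Local Notation lap := (laplacian G sigma).
Local Notation rate := (exit_rate G sigma).
Local Notation ball := (gball G o).

Implicit Types (D : set V) (s t : R) (f g : V -> R) (x y z : V) (n : nat).

Let q_gt0 : 0 < q. Proof. by apply: lt_trans q_gt1. Qed.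

(** The part of the right-hand side that is monotone in [f]: the equation reads
    [u' = reaction u - exit_rate * u]. *)
Definition reaction f x : R := avg G sigma f x + `|f x| `^ q.

Definition datum x : R := a * \1_[set o] x.

Fixpoint picard n : R -> V -> R :=
  if n is m.+1 then fun t x =>
    duhamel (rate x) (datum x) (fun s => reaction (picard m s) x) t
  else fun _ _ => 0.

Lemma picardS n t x : picard n.+1 t x =
  duhamel (rate x) (datum x) (fun s => reaction (picard n s) x) t.
Proof. by []. Qed.

Lemma datum_ge0 x : 0 <= datum x.
Proof. by rewrite mulr_ge0// ltW. Qed.

Lemma reaction_ge0 f x : (forall y, 0 <= f y) -> 0 <= reaction f x.
Proof. by move=> f0; rewrite addr_ge0 ?powR_ge0 ?avg_ge0. Qed.

Lemma le_reaction f g x : (forall y, 0 <= f y) -> (forall y, f y <= g y) ->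
  reaction f x <= reaction g x.
Proof.
move=> f0 fg; rewrite lerD ?le_avg//.
have g0 : 0 <= g x by apply: le_trans (fg x).
rewrite !ger0_norm//; apply: ge0_ler_powR; rewrite ?nnegrE//; exact: ltW.
Qed.

Lemma reaction_cst c x : 0 <= c -> reaction (fun=> c) x = rate x * c + c `^ q.
Proof. by move=> c0; rewrite /reaction avg_cst ger0_norm. Qed.

Lemma cvg_reaction T (F : set_system T) {FF : Filter F} (u : T -> V -> R)
  (l : V -> R) x : (forall y, u t y @[t --> F] --> l y) ->
  reaction (u t) x @[t --> F] --> reaction l x.
Proof.
move=> ul; apply: cvgD; first exact: cvg_avg.
exact: (cvg_comp _ _ (ul x) (@continuous_norm_powR R q q_gt1 (l x))).
Qed.

Lemma continuous_reaction (u : R -> V -> R) x :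
  (forall y, continuous (u^~ y)) -> continuous (fun s => reaction (u s) x).
Proof. by move=> uc s; apply: cvg_reaction => y; exact: uc. Qed.

Lemma continuous_picard n x : continuous (picard n ^~ x).
Proof.
elim: n x => [|n IH] x /=; first exact: cst_continuous.
by apply: continuous_duhamel; exact: continuous_reaction.
Qed.

Lemma picard_ge0 n t x : 0 <= t -> 0 <= picard n t x.
Proof.
elim: n t x => [|n IH] t x t0 //=; apply: duhamel_ge0; first exact: datum_ge0.
by move=> s s0; apply: reaction_ge0 => y; exact: IH.
Qed.

Lemma picard_leS n t x : 0 <= t -> picard n t x <= picard n.+1 t x.
Proof.
elim: n t x => [|n IH] t x t0; first exact: (@picard_ge0 1).
rewrite [leLHS]picardS [leRHS]picardS; apply: le_duhamel.
- by apply: continuous_reaction => y; exact: continuous_picard.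
- by apply: continuous_reaction => y; exact: continuous_picard.
move=> s s0; apply: le_reaction => y; [exact: picard_ge0|exact: IH].
Qed.

(** Finite speed of propagation of the iteration: one edge per step. *)
Lemma picard_supp n t x : ~ ball n x -> picard n t x = 0.
Proof.
elim: n t x => // n IH t x Bx /=.
have dx : datum x = 0.
  rewrite /datum indicE memNset ?mulr0//= => xo; apply: Bx; rewrite xo.
  exact: gball_center.
rewrite dx /duhamel add0r (_ : (fun s => _) = fun=> 0).
  by rewrite /primitive Rintegral_cst// mul0r mulr0.
apply/funext => s; rewrite /reaction IH; last by move=> ?; apply: Bx; left.
rewrite normr0 powR0 ?gt_eqF// addr0 /avg fsbig1 ?mulr0// => y xy.
rewrite IH ?mulr0// => By; apply: Bx; right; exists y => //.
by rewrite /nbh/= adj_sym.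
Qed.

(** As [picard n] has not left [D], only a supersolution on [D] is needed, with
    no condition beyond nonnegativity outside. The induction step compares the
    derivatives of [U] and of the next iterate after multiplication by
    [exp(rate t)]: the monotone part of the equation sees only the previous
    iterate, which is already below [U]. *)
Lemma picard_le_supersolution D (T : R) (U dU : R -> V -> R) n :
  ball n `<=` D ->
  (forall x, D x -> continuous (U^~ x)) ->
  (forall s x, 0 <= s -> s <= T -> 0 <= U s x) ->
  (forall x, D x -> datum x <= U 0 x) ->
  (forall s x, 0 < s -> s < T -> D x -> is_derive s 1 (U^~ x) (dU s x)) ->
  (forall s x, 0 < s -> s < T -> D x -> lap (U s) x + U s x `^ q <= dU s x) ->
  forall t x, 0 <= t -> t <= T -> picard n t x <= U t x.
Proof.
move=> + Uc U0 Ui Ud UdU; elim: n => [|n IH] nD t x t0 tT; first exact: U0.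
have nD' : ball n `<=` D by apply: subset_trans nD; exact: gballS.
have [Dx|Dx] := pselect (D x); last first.
  by rewrite picard_supp ?U0// => Bx; apply: Dx; exact: nD.
pose g s := reaction (picard n s) x.
have gc : continuous g by apply: continuous_reaction => y; exact: continuous_picard.
have Pc := continuous_primitive (@continuous_expR_weight R (rate x) g gc).
have wUc := @continuous_expR_weight R (rate x) (U^~ x) (Uc x Dx).
pose H s := expR (rate x * s) * U s x -
  (datum x + primitive (fun s => expR (rate x * s) * g s) s).
suff : 0 <= H t.
  by rewrite /H duhamel_expR -mulrBr pmulr_rge0 ?expR_gt0// subr_ge0.
apply: (@ge0_of_derive_ge0 R H (fun s =>
    expR (rate x * s) * dU s x + U s x * (rate x * expR (rate x * s)) -
    (0 + expR (rate x * s) * g s)) t t0).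
- have cPc : continuous (fun s => datum x +
      primitive (fun s => expR (rate x * s) * g s) s).
    move=> s; apply: (@continuousD _ _ _ (cst (datum x))); last exact: Pc.
    exact: cst_continuous.
  by move=> s; exact: (continuousB (wUc s) (cPc s)).
- move=> s s0 st; apply: is_derive_sub.
    apply: is_derive_mul; first exact: is_derive_expRM.
    by apply: Ud => //; exact: lt_le_trans tT.
  apply: is_deriveD; apply: is_derive_primitive => //.
  exact: continuous_expR_weight.
- move=> s s0 st; have sT : s < T by exact: lt_le_trans tT.
  rewrite (_ : _ - _ = expR (rate x * s) * (dU s x + rate x * U s x - g s));
    last by ring.
  rewrite mulr_ge0 ?expR_ge0// subr_ge0.
  apply: (@le_trans _ _ (reaction (U s) x)).
    apply: le_reaction => y; first exact: picard_ge0 (ltW s0).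
    by apply: IH => //; exact: ltW.
  have Us : 0 <= U s x by apply: U0; exact: ltW.
  have := UdU s x s0 sT Dx; rewrite laplacianE /reaction ger0_norm//.
  by rewrite addrAC lerBlDr.
- by rewrite /H mulr0 expR0 mul1r primitive0// addr0 subr_ge0 Ui.
Qed.

End Picard.

(** * The limit of a bounded iteration solves the equation *)

Section Limit.
Context {R : realType} {V : choiceType}.
Variables (G : weightedGraph R V) (sigma : V -> R).
Hypothesis sigma_gt0 : forall x, 0 < sigma x.
Variables (q : R) (o : V) (a M : R).
Hypotheses (q_gt1 : 1 < q) (a_gt0 : 0 < a).

Local Notation rate := (exit_rate G sigma).
Local Notation ball := (gball G o).
Local Notation picard := (picard G sigma q o a).
Local Notation reaction := (reaction G sigma q).
Local Notation datum := (datum o a).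

Hypothesis picard_le : forall n t x, 0 <= t -> picard n t x <= M.

Implicit Types (s t : R) (x y z : V) (n : nat).

Let M_ge0 : 0 <= M. Proof. exact: (picard_le 0 o (lexx 0)). Qed.

(** Time is clamped at 0 so that the limit is Lipschitz, hence continuous, on
    the whole line, as the calculus of primitives requires. *)
Definition picard_lim t x : R := limn (fun n => picard n (Num.max t 0) x).

Lemma is_cvg_picard t x : cvgn (fun n => picard n (Num.max t 0) x).
Proof.
have t0 : 0 <= Num.max t 0 by rewrite le_max lexx orbT.
apply: nondecreasing_is_cvgn.
  by apply/nondecreasing_seqP => n; exact: picard_leS.
by exists M => _ [n _ <-]; exact: picard_le.
Qed.

Lemma cvg_picard t x : 0 <= t -> picard n t x @[n --> \oo] --> picard_lim t x.
Proof. by move=> t0; have := @is_cvg_picard t x; rewrite /picard_lim max_l. Qed.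

Lemma picard_lim_ge0 t x : 0 <= picard_lim t x.
Proof.
apply: limr_ge; first exact: is_cvg_picard.
by apply: nearW => n; apply: picard_ge0 => //; rewrite le_max lexx orbT.
Qed.

Lemma reaction_picard_le n t x : 0 <= t ->
  `|reaction (picard n t) x| <= rate x * M + M `^ q.
Proof.
move=> t0; rewrite ger0_norm; last first.
  by apply: reaction_ge0 => // y; exact: picard_ge0.
rewrite -(reaction_cst G sigma q)//; apply: le_reaction => // y.
  exact: picard_ge0.
exact: picard_le.
Qed.

Lemma picard_lipschitz n x s t : 0 <= s -> 0 <= t ->
  `|picard n t x - picard n s x| <= (rate x * M + M `^ q + rate x * M) * `|t - s|.
Proof.
have r0 : 0 <= rate x by exact/ltW/exit_rate_gt0.
case: n => [|n] s0 t0.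
  by rewrite subrr normr0 !mulr_ge0// !addr_ge0 ?powR_ge0// mulr_ge0.
rewrite !picardS; apply: duhamel_lipschitz => //.
- by apply: continuous_reaction => // y; exact: continuous_picard.
- by move=> r r0'; exact: reaction_picard_le.
- move=> r r0'; rewrite -picardS ger0_norm ?picard_ge0//; exact: picard_le.
Qed.

Lemma picard_lim_lipschitz x s t :
  `|picard_lim t x - picard_lim s x| <=
  (rate x * M + M `^ q + rate x * M) * `|t - s|.
Proof.
have m0 (r : R) : 0 <= Num.max r 0 by rewrite le_max lexx orbT.
have clampE r : picard_lim r x = picard_lim (Num.max r 0) x.
  by rewrite /picard_lim (max_l (m0 r)).
have r0 : 0 <= rate x by exact/ltW/exit_rate_gt0.
rewrite clampE (clampE s).
apply: (@le_trans _ _ ((rate x * M + M `^ q + rate x * M) *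
    `|Num.max t 0 - Num.max s 0|)).
  have cv :
      `|picard n (Num.max t 0) x - picard n (Num.max s 0) x| @[n --> \oo] -->
      `|picard_lim (Num.max t 0) x - picard_lim (Num.max s 0) x|.
    by apply: cvg_norm; apply: cvgB; exact: cvg_picard.
  rewrite -(cvg_lim _ cv)//; apply: limr_le; first exact: (cvgP _ cv).
  by apply: nearW => n; exact: picard_lipschitz.
rewrite ler_wpM2l//; first by rewrite !addr_ge0 ?powR_ge0// mulr_ge0.
have [t0|t0] := leP t 0; have [s0|s0] := leP s 0; rewrite ?subrr ?normr0//.
- rewrite sub0r normrN (ger0_norm (ltW s0)) distrC.
  by apply: le_trans (ler_norm _); rewrite lerDl oppr_ge0.
- rewrite subr0 (ger0_norm (ltW t0)).
  by apply: le_trans (ler_norm _); rewrite lerDl oppr_ge0.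
Qed.

Lemma continuous_picard_lim x : continuous (picard_lim^~ x).
Proof.
set L := rate x * M + M `^ q + rate x * M.
have L0 : 0 <= L.
  have r0 : 0 <= rate x by exact/ltW/exit_rate_gt0.
  by rewrite /L !addr_ge0 ?powR_ge0// mulr_ge0.
move=> t; apply/cvgrPdist_le => e e0; near=> s.
apply: le_trans (picard_lim_lipschitz x s t) _; rewrite -/L.
apply: (@le_trans _ _ ((L + 1) * `|t - s|)); first by rewrite ler_wpM2r// lerDl.
rewrite mulrC -ler_pdivlMr; last by rewrite ltr_wpDl.
near: s; apply/nbhs_ballP; exists (e / (L + 1)) => [/=|s /ltW//].
by rewrite divr_gt0// ltr_wpDl.
Unshelve. all: by end_near. Qed.

(** This agrees with [picard_lim] for nonnegative times, and the formula makes
    the differentiability in time evident. *)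
Definition solution t x : R :=
  duhamel (rate x) (datum x) (fun s => reaction (picard_lim s) x) t.

Lemma continuous_reaction_picard_lim x :
  continuous (fun s => reaction (picard_lim s) x).
Proof. by apply: continuous_reaction => // y; exact: continuous_picard_lim. Qed.

Lemma solutionE t x : 0 <= t -> picard_lim t x = solution t x.
Proof.
move=> t0; have := @cvg_picard _ x t0.
rewrite -(cvg_shiftS (fun n => picard n t x)) => cv.
apply: (cvg_unique _ cv) => //.
apply: (@cvg_duhamel _ _ _ (fun n s => reaction (picard n s) x) _
  (rate x * M + M `^ q)).
- by move=> n; apply: continuous_reaction => // y; exact: continuous_picard.
- exact: continuous_reaction_picard_lim.
- by move=> n s s0; exact: reaction_picard_le.
- exact/ltW/exit_rate_gt0.
- by move=> s s0; apply: cvg_reaction => // y; exact: cvg_picard.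
Qed.

(** Positivity at [o] comes from the datum; at distance [n + 1] it comes from a
    neighbour at distance [n], which is positive at all earlier times. *)
Lemma solution_gt0 t x : 0 < t -> 0 < solution t x.
Proof.
have rl0 y s : 0 <= reaction (picard_lim s) y.
  by apply: reaction_ge0 => // z; exact: picard_lim_ge0.
have [n _] : (\bigcup_n ball n) x by rewrite gball_cover.
elim: n x t => [x t -> t0|n IH x t [|[y By xy]] t0]; last 2 first.
- by move=> /IH; exact.
- apply: duhamel_gt0r => //; first exact: datum_ge0.
    exact: continuous_reaction_picard_lim.
  move=> s s0; apply: ltr_pwDl; last exact: powR_ge0.
  apply: (@avg_gt0 _ _ _ _ sigma_gt0 _ _ y); last 2 first.
  + by rewrite adj_sym.
  + by rewrite solutionE ?ltW// IH.
  + by move=> z; exact: picard_lim_ge0.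
- apply: duhamel_gt0l => // ; by rewrite /datum indicE mem_set// mulr1.
Qed.

Lemma solution_is_classical :
  positive_classical_solution G sigma q (fun x => a * \1_[set o] x) solution.
Proof.
have eqlim t : 0 <= t -> picard_lim t = solution t.
  by move=> t0; apply/funext => x; exact: solutionE.
have sc x : continuous (solution ^~ x).
  by apply: continuous_duhamel; exact: continuous_reaction_picard_lim.
have sd x t : 0 < t -> is_derive t 1 (solution ^~ x)
    (reaction (picard_lim t) x - rate x * solution t x).
  move=> t0; apply: is_derive_duhamel => //.
  exact: continuous_reaction_picard_lim.
split.
- by move=> t x t0; rewrite -solutionE//; exact: picard_lim_ge0.
- by move=> x; apply: continuous_subspaceT; exact: sc.
- move=> x t t0; split; first by case: (sd x t t0).
  pose d s := reaction (picard_lim s) x - rate x * solution s x.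
  have dE s : 0 < s -> derive1 (solution ^~ x) s = d s.
    by move=> s0; rewrite derive1E; have [_ ->] := sd x s s0.
  have near_dE : {near t, d =1 derive1 (solution ^~ x)}.
    by near=> s; apply/esym/dE; near: s; exact: lt_nbhsr.
  rewrite /prop_for /continuous_at dE//.
  apply: (cvg_trans (near_eq_cvg near_dE)).
  apply: cvgB; first exact: continuous_reaction_picard_lim.
  by apply: cvgMl_tmp; exact: sc.
- move=> t x t0; rewrite derive1E; have [_ ->] := sd x t t0.
  rewrite laplacianE /reaction eqlim ?(ltW t0)// ger0_norm ?ltW ?solution_gt0//.
  ring.
- split; first by move=> x; rewrite /solution duhamel0.
  by move=> t x t0; exact: solution_gt0.
Unshelve. all: by end_near. Qed.

End Limit.

(** * The supersolution *)

Section Profile.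
Context {R : realType}.
Variables (m : nat -> R) (S : R).
Hypothesis m_ge0 : forall k, 0 <= m k.
Hypothesis m_sum : forall n : nat, \sum_(0 <= k < n) 4 ^+ k * m k <= S.

(** Each scale [4 ^ k] contributes a relaxation with time constant [4 ^ k]: its
    total increase is [4 ^ k * m k], while its slope is at
    least [exp(-4) * m k] up to time [4 ^ k.+1]. Thus a slope at least of order
    [m k] at scale [4 ^ k] is obtained from a smooth function with total
    increase at most [S]. *)
Definition growth (N : nat) (t : R) : R :=
  \sum_(0 <= k < N) 4 ^+ k * m k * (1 - expR (- (4 ^+ k)^-1 * t)).

Definition growth_rate (N : nat) (t : R) : R :=
  \sum_(0 <= k < N) m k * expR (- (4 ^+ k)^-1 * t).

Lemma is_derive_growth N (t : R) : is_derive t 1 (growth N) (growth_rate N t).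
Proof.
elim: N => [|N IH].
  rewrite /growth_rate big_geq// (_ : growth 0 = cst 0); first exact: is_derive_cst.
  by apply/funext => s; rewrite /growth big_geq.
rewrite /growth_rate big_nat_recr//= (_ : growth N.+1 = fun s =>
    growth N s + (4 ^+ N * m N - 4 ^+ N * m N * expR (- (4 ^+ N)^-1 * s))); last first.
  by apply/funext => s; rewrite /growth big_nat_recr//= [in LHS]mulrBr mulr1.
apply: is_deriveD.
have -> : m N * expR (- (4 ^+ N)^-1 * t) =
    0 - (4 ^+ N * m N * (- (4 ^+ N)^-1 * expR (- (4 ^+ N)^-1 * t)) +
         expR (- (4 ^+ N)^-1 * t) * 0).
  by field; rewrite expf_neq0.
apply: is_derive_sub; apply: is_derive_mul; exact: is_derive_expRM.
Qed.

Lemma growth0 N : growth N 0 = 0.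
Proof. by rewrite /growth big1// => k _; rewrite mulr0 expR0 subrr mulr0. Qed.

Lemma growth_ge0 N t : 0 <= t -> 0 <= growth N t.
Proof.
move=> t0; apply: sumr_ge0 => k _; rewrite !mulr_ge0 ?exprn_ge0//.
by rewrite subr_ge0 -expR0 ler_expR mulNr oppr_le0 mulr_ge0 ?invr_ge0 ?exprn_ge0.
Qed.

Lemma growth_le N t : growth N t <= S.
Proof.
apply: le_trans (m_sum N); apply: ler_sum => k _.
by rewrite ler_piMr ?mulr_ge0 ?exprn_ge0// lerBlDr lerDl expR_ge0.
Qed.

Lemma growth_rate_ge N k t : (k < N)%N -> t <= 4 ^+ k.+1 ->
  m k <= expR 4 * growth_rate N t.
Proof.
move=> kN tk.
have : m k * expR (- (4 ^+ k)^-1 * t) <= growth_rate N t.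
  rewrite /growth_rate (bigD1_seq k)//= ?mem_index_iota ?iota_uniq//.
  by rewrite lerDl sumr_ge0// => i _; rewrite mulr_ge0 ?expR_ge0.
move=> /(ler_wpM2l (expR_ge0 4)); apply: le_trans.
rewrite mulrCA -expRD ler_peMr// -[leLHS]expR0 ler_expR mulNr subr_ge0.
by rewrite mulrC ler_pdivrMr ?exprn_gt0// -exprS.
Qed.

Lemma dyadic_scale N (t : R) : t <= 4 ^+ N.+1 ->
  exists2 k, (k < N.+1)%N & t <= 4 ^+ k.+1 /\ (k = 0%N \/ 4 ^+ k <= t).
Proof.
elim: N => [|N IH] tN; first by exists 0%N; rewrite // expr1; split; [|left].
have [/IH[k kN kP]|tN'] := leP t (4 ^+ N.+1); first by exists k => //; exact: ltnW.
by exists N.+1 => //; split => //; right; exact: ltW.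
Qed.

End Profile.

Section Supersolution.
Context {R : realType} {V : choiceType}.
Variables (G : weightedGraph R V) (sigma : V -> R).
Hypothesis sigma_gt0 : forall x, 0 < sigma x.
Variables (rho : V -> V -> R) (q : R) (o : V) (C : R).
Hypotheses (rho_length : edge_length G rho) (rho_proper : proper_dist G rho).
Hypotheses (q_gt1 : 1 < q) (C_gt0 : 0 < C).

Local Notation nu := (nu G sigma).
Local Notation lap := (laplacian G sigma).
Local Notation heat := (heat_semigroup G sigma).
Local Notation vol := (volume G sigma rho o).
Local Notation ball := (gball G o).

Implicit Types (D : set V) (s t : R) (x y z : V).

Hypothesis kernel_bound : forall t x, 1 <= t ->
  minimal_kernel G sigma t o x <= C / vol (Num.sqrt t).

Let p : R := q - 1.
Let L : R := Num.max (vol 1) (nu o * C).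

Let vol_gt0 r : 0 <= r -> 0 < vol r. Proof. exact: volume_gt0. Qed.

Lemma heat_point_decay D t x : finite_set D -> D o -> 1 <= t ->
  heat D t (\1_[set o]) x <= nu o * C / vol (Num.sqrt t).
Proof.
move=> Df Do t1; have t0 : 0 <= t by exact: le_trans t1.
have v0 : 0 < vol (Num.sqrt t) by apply: vol_gt0; exact: sqrtr_ge0.
have nu0 := nu_gt0 G sigma_gt0.
have [Dx|Dx] := pselect (D x); last first.
  by rewrite heat_notin// divr_ge0 ?ltW// mulr_gt0.
have -> : heat D t (\1_[set o]) x = nu o * dirichlet_kernel G sigma D t o x.
  rewrite dirichlet_kernel_sym// /dirichlet_kernel mulrCA divff ?mulr1//.
  by rewrite gt_eqF.
rewrite -mulrA ler_pM2l//; apply: le_trans (kernel_bound x t1).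
exact: dirichlet_kernel_le_minimal.
Qed.

(** [L] covers both regimes: the kernel bound for [t >= 1], and the trivial
    bound [w <= 1] for [t <= 1], where only the scale [k = 0] is used. *)
Lemma heat_point_le D k t x : finite_set D -> D o -> 0 <= t ->
  t <= 4 ^+ k.+1 -> k = 0%N \/ 4 ^+ k <= t ->
  heat D t (\1_[set o]) x * vol (2 ^+ k) <= L.
Proof.
move=> Df Do t0 tk kt.
have vk : 0 < vol (2 ^+ k) by apply: vol_gt0; exact: exprn_ge0.
have [t1|t1] := leP 1 t.
  have kt' : 4 ^+ k <= t by case: kt => // ->; rewrite expr0.
  have st : 2 ^+ k <= Num.sqrt t.
    rewrite -(ger0_norm (exprn_ge0 k (ler0n R 2))) -sqrtr_sqr ler_wsqrtr//.
    by rewrite -exprM mulnC exprM (_ : 2 ^+ 2 = 4)// -natrX.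
  rewrite -ler_pdivlMr//; apply: le_trans (heat_point_decay x Df Do t1) _.
  have nC : 0 <= nu o * C by rewrite mulr_ge0 ?ltW ?nu_gt0.
  apply: (@le_trans _ _ (nu o * C / vol (2 ^+ k))).
    by rewrite ler_wpM2l// lef_pV2 ?posrE ?vol_gt0 ?sqrtr_ge0// le_volume.
  by rewrite ler_wpM2r ?invr_ge0 ?(ltW vk)// le_max lexx orbT.
case: kt => [->|kt]; last first.
  move: (lt_le_trans (le_lt_trans kt t1) (exprn_ege1 k (ler1n R 4))).
  by rewrite ltxx.
rewrite expr0 (le_trans _ (_ : vol 1 <= _))//; last by rewrite le_max lexx.
rewrite ler_piMl ?(ltW (vol_gt0 _))//; apply: heat_le => // y.
Qed.

(** The constant [2 `^ q * (a * L) `^ p] bounds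
    [phi ^ q * (a w) ^ (q - 1) * M_o(2 ^ k) ^ (q - 1)] when [phi <= 2]; the
    factor [expR 4] makes up for the loss in the slope of [growth]. *)
Lemma picard_bounded (a S : R) : 0 < a ->
  (forall n : nat, \sum_(0 <= k < n) 4 ^+ k / vol (2 ^+ k) `^ p <= S) ->
  2 `^ q * (a * L) `^ p * expR 4 * S <= 1 ->
  forall n t x, 0 <= t -> picard G sigma q o a n t x <= 2 * a.
Proof.
move=> a0 mS small n t x t0.
set A := 2 `^ q * (a * L) `^ p in small.
pose m k := (vol (2 ^+ k) `^ p)^-1.
have p0 : 0 < p by rewrite subr_gt0.
have q0 : 0 < q by exact: lt_trans q_gt1.
have vk k : 0 < vol (2 ^+ k) by apply: vol_gt0; exact: exprn_ge0.
have m0 k : 0 <= m k by rewrite invr_ge0 powR_ge0.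
have A0 : 0 <= A by rewrite mulr_ge0 ?powR_ge0.
have B0 : 0 <= A * expR 4 by rewrite mulr_ge0 ?expR_ge0.
have [N tN] : exists N, t <= 4 ^+ N.+1.
  (* A finite horizon keeps the sum over scales finite. *)
  exists (Num.bound t); apply: le_trans (ltW (archi_boundP t0)) _.
  rewrite -natrX ler_nat; apply: ltnW.
  apply: leq_trans (ltn_expl _ (isT : 1 < 4)%N) _.
  by rewrite leq_exp2l.
pose D := ball n.
have Df : finite_set D by exact: gball_finite.
have Do : D o by exact: gball_center.
pose w s y := heat D s (\1_[set o]) y.
pose phi s := 1 + A * expR 4 * growth m N.+1 s.
have phi1 s : 0 <= s -> 1 <= phi s.
  by move=> s0; rewrite lerDl mulr_ge0// growth_ge0.
have phi2 s : phi s <= 2.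
  have : A * expR 4 * growth m N.+1 s <= 1.
    by apply: le_trans small; rewrite ler_wpM2l//; apply: growth_le.
  by rewrite /phi; lra.
have phid s : is_derive s 1 phi (A * expR 4 * growth_rate m N.+1 s).
  have := is_derive_growth m N.+1 s.
  move=> /(is_derive_mul (is_derive_cst (A * expR 4) s 1)) H.
  have := is_deriveD (is_derive_cst (1 : R) s 1) H.
  by rewrite add0r mulr0 addr0.
have w0 s y : 0 <= s -> 0 <= w s y by move=> s0; apply: heat_ge0.
have w1 s y : 0 <= s -> w s y <= 1.
  by move=> s0; apply: heat_le => // z; rewrite indicE lern1 leq_b1.
have reaction_le s y : 0 <= s -> s <= 4 ^+ N.+1 ->
    (phi s * (a * w s y)) `^ q <= a * w s y * (A * expR 4 * growth_rate m N.+1 s).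
  move=> s0 sN.
  have [k kN [sk ks]] := dyadic_scale sN.
  have aw0 : 0 <= a * w s y by rewrite mulr_ge0 ?w0// ltW.
  have ph0 : 0 <= phi s by apply: le_trans (phi1 _ s0).
  rewrite powRM// -(mulr_powRB1 aw0 q0) mulrCA ler_wpM2l//.
  apply: (@le_trans _ _ (A * m k)); last first.
    by rewrite -[leRHS]mulrA ler_wpM2l//; apply: growth_rate_ge.
  rewrite /A -mulrA; apply: ler_pM; rewrite ?powR_ge0//.
    by apply: ge0_ler_powR; rewrite ?nnegrE// ltW.
  rewrite /m ler_pdivlMr ?powR_gt0// -powRM ?(ltW (vk k))//.
  apply: ge0_ler_powR; rewrite ?nnegrE ?(ltW p0)//.
  - by rewrite mulr_ge0// ltW.
  - by rewrite mulr_ge0 ?(ltW a0)// le_max ltW ?vol_gt0.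
  - by rewrite -mulrA ler_pM2l//; apply: heat_point_le.
pose U s y := phi s * (a * w s y).
pose dU s y := phi s * (a * lap (w s) y) +
  a * w s y * (A * expR 4 * growth_rate m N.+1 s).
apply: (@le_trans _ _ (U t x)).
  apply: (@picard_le_supersolution _ _ _ _ sigma_gt0 q o a q_gt1 a0 D
    (4 ^+ N.+1) U dU);
    [by []| | | | | |exact: t0|exact: tN].
  - move=> y _ s; apply: (continuousM (@continuous_of_is_derive R phi _ phid s)).
    by apply: cvgMl_tmp; exact: continuous_heat.
  - move=> s y s0 sT; rewrite mulr_ge0// ?(le_trans _ (phi1 _ s0))//.
    by rewrite mulr_ge0 ?w0// ltW.
  - move=> y Dy; rewrite /U /phi growth0 mulr0 addr0 mul1r /w heat0 restrictE.
    by rewrite mem_set.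
  - move=> s y s0 sT Dy; apply: is_derive_mul => //.
    have := is_derive_mul (is_derive_cst a s 1)
      (is_derive_heat_in G sigma s (\1_[set o]) Df Dy).
    by rewrite mulr0 addr0.
  - move=> s y s0 sT Dy; rewrite /U /dU laplacianZ laplacianZ lerD2l.
    by apply: reaction_le; exact: ltW.
rewrite /U; apply: ler_pM => //.
- by apply: le_trans (phi1 _ t0).
- by rewrite mulr_ge0 ?w0// ltW.
- by rewrite ler_piMr ?w1// ltW.
Qed.

End Supersolution.

Theorem corollary1p9 (R : realType) (V : choiceType) (G : weightedGraph R V)
    (sigma : V -> R) (sigma_gt0 : forall x, 0 < sigma x)
    (rho : V -> V -> R) (rho_length : edge_length G rho)
    (rho_adapted : adapted G sigma rho) (rho_proper : proper_dist G rho)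
    (q : R) (q_gt1 : 1 < q) (o : V) (C : R) (C_gt0 : 0 < C)
    (kernel_bound : forall t : R, 1 <= t ->
       (ereal_sup (range (fun x => (minimal_kernel G sigma t o x)%:E))
          <= (C / volume G sigma rho o (Num.sqrt t))%:E)%E)
    (volume_int :
       (\int[lebesgue_measure]_(r in `[(1%R : R), +oo[)
          (r / volume G sigma rho o r `^ (q - 1))%:E < +oo)%E) :
  exists2 a0 : R, 0 < a0 & forall a : R, 0 < a -> a <= a0 ->
    exists u : R -> V -> R,
      positive_classical_solution G sigma q (fun x => a * \1_[set o] x) u.
Proof.
have kb t x : 1 <= t ->
    minimal_kernel G sigma t o x <= C / volume G sigma rho o (Num.sqrt t).
  move=> /kernel_bound; rewrite -lee_fin; apply: le_trans.
  by apply: ereal_sup_ubound; exists x.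
have p0 : 0 < q - 1 by rewrite subr_gt0.
have [S mS] := volume_sum_bounded sigma_gt0 rho_length rho_proper p0 volume_int.
have S0 : 0 <= S by have := mS 0%N; rewrite big_geq.
set L := Num.max (volume G sigma rho o 1) (nu G sigma o * C).
have L0 : 0 < L by rewrite lt_max volume_gt0.
pose K := 2 `^ q * L `^ (q - 1) * expR 4 * (S + 1).
have K0 : 0 < K by rewrite !mulr_gt0 ?powR_gt0 ?expR_gt0// ltr_wpDl.
(* This solves [K * a0 ^ (q - 1) = 1]; [S + 1] in [K] avoids dividing by 0. *)
exists (K^-1 `^ (q - 1)^-1); first by rewrite powR_gt0// invr_gt0.
move=> a a_gt0 aa0.
have ap : a `^ (q - 1) <= K^-1.
  have -> : K^-1 = (K^-1 `^ (q - 1)^-1) `^ (q - 1).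
    by rewrite -powRrM mulVf ?gt_eqF// powRr1// invr_ge0 ltW.
  by apply: ge0_ler_powR; rewrite ?nnegrE ?powR_ge0// ltW.
have small : 2 `^ q * (a * L) `^ (q - 1) * expR 4 * S <= 1.
  rewrite powRM ?(ltW a_gt0) ?(ltW L0)//.
  apply: (@le_trans _ _ (a `^ (q - 1) * K)); last first.
    by rewrite -ler_pdivlMr// mul1r.
  rewrite /K (_ : _ * S =
    a `^ (q - 1) * (2 `^ q * L `^ (q - 1) * expR 4 * S)); last by ring.
  rewrite ler_wpM2l ?powR_ge0// ler_wpM2l ?mulr_ge0 ?powR_ge0 ?expR_ge0//.
  by rewrite lerDl.
have bnd := picard_bounded sigma_gt0 rho_length rho_proper q_gt1 C_gt0 kb
  a_gt0 mS small.
exists (solution G sigma q o a).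
exact: (solution_is_classical sigma_gt0 q_gt1 a_gt0 bnd).
Qed.
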